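(* Let $\mathcal{A}$ be a small abelian category and let $\mathcal{C}\subseteq\mathcal{A}$ be a full additive, strictly full, Karoubi closed subcategory which is $\mathcal{A}$-approximating. (i) The inclusion $\mathcal{T}_{\mathcal{C}}\hookrightarrow\mathcal{T}_{\mathcal{A}}$ is right $t$-exact (i.e. it maps $\mathcal{T}^{\leq 0}_{\mathcal{C}}$ into $\mathcal{T}^{\leq 0}_{\mathcal{A}}$); hence $\tau^{\geq 0}_{\mathcal{A}}(\mathcal{H}_{\mathcal{C}})\subseteq\mathcal{H}_{\mathcal{A}}$ and $\tau^{\geq 0}_{\mathcal{A}}:\mathcal{H}_{\mathcal{C}}\to\mathcal{H}_{\mathcal{A}}$ is right exact. (ii) $\tau^{\geq 0}_{\mathcal{A}}:\mathcal{H}_{\mathcal{C}}\to\mathcal{H}_{\mathcal{A}}$ is left adjoint to $\pi_{\mathcal{C}}:\mathcal{H}_{\mathcal{A}}\to\mathcal{H}_{\mathcal{C}}$, and the adjunction morphism $\mathrm{Id}_{\mathcal{H}_{\mathcal{C}}}\to\pi_{\mathcal{C}}\circ\tau^{\geq 0}_{\mathcal{A}}|_{\mathcal{H}_{\mathcal{C}}}$ is an isomorphism. (iii) $\pi_{\mathcal{C}}:\mathcal{H}_{\mathcal{A}}\to\mathcal{H}_{\mathcal{C}}$ is exact. (iv) Let $\mathbf{A}=\mathrm{Ker}(\pi_{\mathcal{C}}|_{\mathcal{H}_{\mathcal{A}}})$ be the class of objects of $\mathcal{H}_{\mathcal{A}}$ killed by $\pi_{\mathcal{C}}$. Let $\mu:\tau^{\geq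 0}_{\mathcal{A}}\circ\pi_{\mathcal{C}}|_{\mathcal{H}_{\mathcal{A}}}\to\mathrm{Id}_{\mathcal{H}_{\mathcal{A}}}$ be the adjunction morphism and let $\mathbf{B}$ be the class of objects isomorphic to $\mathrm{Coker}(\mu_V)$ (cokernel in $\mathcal{H}_{\mathcal{A}}$) for some $V\in\mathcal{H}_{\mathcal{A}}$. Let $\mathbf{C}$ be the class of objects isomorphic to some $[X\to C\times Y\to Z]\in\mathcal{H}_{\mathcal{A}}$ in which the component $C\to Z$ is a $\mathcal{C}$-cover. Then $\mathbf{A}=\mathbf{B}=\mathbf{C}$.
   Context: Strictly full means closed under isomorphisms; Karoubi closed means closed under direct summands in $\mathcal{A}$. $\mathcal{T}_{\mathcal{C}}=K^-(\mathcal{C})$ (bounded above cochain complexes modulo homotopy) is a full triangulated subcategory of $\mathcal{T}_{\mathcal{A}}=K^-(\mathcal{A})$. On $\mathcal{T}_{\mathcal{A}}$ there is a $t$-structure with $\mathcal{T}^{\leq 0}_{\mathcal{A}}$ the strictly full subcategory generated by complexes $X$ with $X^i=0$ for $i>0$, and $\mathcal{T}^{\geq 0}_{\mathcal{A}}$ the strictly full subcategory generated by complexes with $X^i=0$ for $i<-2$ and $H^{-2}(X)=H^{-1}(X)=0$. Its truncation $\tau^{\geq 0}_{\mathcal{A}}$ (left adjoint to the inclusion of $\mathcal{T}^{\geq 0}_{\mathcal{A}}$) is $\tau^{\geq 0}_{\mathcal{A}}X=[0\to\mathrm{Ker}\,d^{-1}_X\to X^{-1}\to X^0\to\cdots]$.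 Its heart $\mathcal{H}_{\mathcal{A}}$ is the abelian category of complexes $[X^{-2}\to X^{-1}\to X^0]$ in $\mathcal{A}$ (degrees $-2,-1,0$) with no cohomology in negative degrees, morphisms modulo homotopy. $\mathcal{T}^{\leq 0}_{\mathcal{C}}:=\mathcal{T}_{\mathcal{C}}\cap\mathcal{T}^{\leq 0}_{\mathcal{A}}$ is a $t$-structure on $\mathcal{T}_{\mathcal{C}}$ (with $\mathcal{T}^{\geq 0}_{\mathcal{C}}=\{X\in\mathcal{T}_{\mathcal{C}}\mid\mathrm{Hom}(\mathcal{T}^{\leq 0}_{\mathcal{C}}[1],X)=0\}$); its heart is the abelian category $\mathcal{H}_{\mathcal{C}}=\mathcal{T}^{\leq 0}_{\mathcal{C}}\cap\mathcal{T}^{\geq 0}_{\mathcal{C}}$. A $\mathcal{C}$-cover of $M\in\mathcal{A}$ is a surjection $C\to M$ in $\mathcal{A}$ with $C\in\mathcal{C}$ such that $\mathrm{Hom}_{\mathcal{C}}(-,C)\to\mathrm{Hom}_{\mathcal{A}}(-,M)|_{\mathcal{C}}$ is surjective. A $\mathcal{C}$-approximation of $X\in\mathcal{T}_{\mathcal{A}}$ is a quasi-isomorphism $X_{\mathcal{C}}\to X$ with $X_{\mathcal{C}}\in\mathcal{T}_{\mathcal{C}}$ inducing an isomorphism $\mathrm{Hom}_{\mathcal{T}_{\mathcal{C}}}(-,X_{\mathcal{C}})\to\mathrm{Hom}_{\mathcal{T}_{\mathcal{A}}}(-,X)|_{\mathcal{T}_{\mathcal{C}}}$. $\mathcal{C}$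 is $\mathcal{A}$-approximating if every $X\in\mathcal{T}_{\mathcal{A}}$ has a $\mathcal{C}$-approximation (equivalently every $M\in\mathcal{A}$ has a $\mathcal{C}$-cover); then $\pi_{\mathcal{C}}X=X_{\mathcal{C}}$ defines a functor $\pi_{\mathcal{C}}:\mathcal{T}_{\mathcal{A}}\to\mathcal{T}_{\mathcal{C}}$ right adjoint to the inclusion, with $\pi_{\mathcal{C}}|_{\mathcal{T}_{\mathcal{C}}}=\mathrm{Id}$, and $\pi_{\mathcal{C}}(\mathcal{H}_{\mathcal{A}})=\mathcal{H}_{\mathcal{C}}$. *)

(* Defs.v *)
From HB Require Import structures.
From mathcomp Require Import all_boot all_order all_algebra.
From mathcomp Require Import boolp.

Set Implicit Arguments.
Unset Strict Implicit.
Unset Printing Implicit Defensive.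

Import Order.TTheory GRing.Theory Num.Theory.
Local Open Scope ring_scope.
Local Open Scope quotient_scope.

Record zcat := ZCat {
  ob :> Type;
  hom : ob -> ob -> zmodType;
  idm : forall X : ob, hom X X;
  cmp : forall X Y Z : ob, hom Y Z -> hom X Y -> hom X Z;
  cmpA : forall (X Y Z T : ob) (h : hom Z T) (g : hom Y Z) (f : hom X Y),
    cmp h (cmp g f) = cmp (cmp h g) f;
  cmp1m : forall (X Y : ob) (f : hom X Y), cmp (idm Y) f = f;
  cmpm1 : forall (X Y : ob) (f : hom X Y), cmp f (idm X) = f;
  cmpDl : forall (X Y Z : ob) (g g' : hom Y Z) (f : hom X Y),
    cmp (g + g') f = cmp g f + cmp g' f;
  cmpDr : forall (X Y Z : ob) (g : hom Y Z) (f f' : hom X Y),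
    cmp g (f + f') = cmp g f + cmp g f' }.

Arguments hom {z} X Y : rename.
Arguments idm {z} X : rename.
Arguments cmp {z X Y Z} g f : rename.

Notation "g \oc f" := (cmp g f) (at level 40, left associativity) : ring_scope.

Section ZcatTheory.
Variable A : zcat.
Implicit Types X Y Z W : A.

Lemma cmp0m X Y Z (f : hom X Y) : (0 : hom Y Z) \oc f = 0.
Proof. by apply: (addrI (0 \oc f)); rewrite -cmpDl !addr0. Qed.

Lemma cmpm0 X Y Z (g : hom Y Z) : g \oc (0 : hom X Y) = 0.
Proof. by apply: (addrI (g \oc 0)); rewrite -cmpDr !addr0. Qed.

Lemma cmpNm X Y Z (g : hom Y Z) (f : hom X Y) : (- g) \oc f = - (g \oc f).
Proof. by apply: (addrI (g \oc f)); rewrite -cmpDl !subrr cmp0m. Qed.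

Lemma cmpmN X Y Z (g : hom Y Z) (f : hom X Y) : g \oc (- f) = - (g \oc f).
Proof. by apply: (addrI (g \oc f)); rewrite -cmpDr !subrr cmpm0. Qed.

Definition is_iso X Y (f : hom X Y) : Prop :=
  exists g : hom Y X, g \oc f = idm X /\ f \oc g = idm Y.

Definition isom X Y : Prop := exists f : hom X Y, is_iso f.

Definition is_zero X : Prop := idm X = 0.

Definition monic X Y (f : hom X Y) : Prop :=
  forall W (g h : hom W X), f \oc g = f \oc h -> g = h.

Definition epic X Y (f : hom X Y) : Prop :=
  forall W (g h : hom Y W), g \oc f = h \oc f -> g = h.

Definition is_kernel X Y Z (f : hom Y Z) (k : hom X Y) : Prop :=
  f \oc k = 0 /\
  forall W (g : hom W Y), f \oc g = 0 -> exists! h : hom W X, k \oc h = g.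

Definition is_cokernel X Y Z (f : hom X Y) (c : hom Y Z) : Prop :=
  c \oc f = 0 /\
  forall W (g : hom Y W), g \oc f = 0 -> exists! h : hom Z W, h \oc c = g.

Definition short_exact X Y Z (f : hom X Y) (g : hom Y Z) : Prop :=
  is_kernel g f /\ is_cokernel f g.

End ZcatTheory.

(** Abelian categories come with a choice of zero object, biproducts, kernels
    and cokernels. *)
Record abcat := AbCat {
  abase :> zcat;
  zob : abase;
  zobP : is_zero zob;
  bip : abase -> abase -> abase;
  injl : forall X Y : abase, hom X (bip X Y);
  injr : forall X Y : abase, hom Y (bip X Y);
  prl : forall X Y : abase, hom (bip X Y) X;
  prr : forall X Y : abase, hom (bip X Y) Y;
  prl_injl : forall X Y : abase, prl X Y \oc injl X Y = idm X;
  prr_injr : forall X Y : abase, prr X Y \oc injr X Y = idm Y;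
  prl_injr : forall X Y : abase, prl X Y \oc injr X Y = 0;
  prr_injl : forall X Y : abase, prr X Y \oc injl X Y = 0;
  bipE : forall X Y : abase,
    injl X Y \oc prl X Y + injr X Y \oc prr X Y = idm (bip X Y);
  ker : forall X Y : abase, hom X Y -> abase;
  kerm : forall (X Y : abase) (f : hom X Y), hom (ker f) X;
  kerP : forall (X Y : abase) (f : hom X Y), is_kernel f (kerm f);
  coker : forall X Y : abase, hom X Y -> abase;
  cokerm : forall (X Y : abase) (f : hom X Y), hom Y (coker f);
  cokerP : forall (X Y : abase) (f : hom X Y), is_cokernel f (cokerm f);
  monic_normal : forall (X Y : abase) (f : hom X Y),
    monic f -> exists (Z : abase) (g : hom Y Z), is_kernel g f;
  epic_normal : forall (X Y : abase) (f : hom X Y),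
    epic f -> exists (W : abase) (g : hom W X), is_cokernel g f }.

Arguments zob {a} : rename.
Arguments bip {a} X Y : rename.
Arguments injl {a} X Y : rename.
Arguments injr {a} X Y : rename.
Arguments prl {a} X Y : rename.
Arguments prr {a} X Y : rename.
Arguments ker {a X Y} f : rename.
Arguments kerm {a X Y} f : rename.
Arguments kerP {a X Y} f : rename.
Arguments coker {a X Y} f : rename.
Arguments cokerm {a X Y} f : rename.
Arguments cokerP {a X Y} f : rename.

Section AbTheory.
Variable A : abcat.
Implicit Types X Y Z W : A.

Definition kerlift X Y W (f : hom X Y) (g : hom W X) (fg : f \oc g = 0) :
    hom W (ker f) :=
  sval (cid ((kerP f).2 W g fg)).

Lemma kerliftE X Y W (f : hom X Y) (g : hom W X) (fg : f \oc g = 0) :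
  kerm f \oc kerlift fg = g.
Proof. by rewrite /kerlift; case: cid => h []. Qed.

Lemma kerm_monic X Y (f : hom X Y) : monic (kerm f).
Proof.
move=> W g h gh.
have fg : f \oc (kerm f \oc g) = 0 by rewrite cmpA (kerP f).1 cmp0m.
have [u [_ uu]] := (kerP f).2 _ _ fg.
by rewrite -(uu g erefl) -(uu h (esym gh)).
Qed.

Definition cokerdesc X Y W (f : hom X Y) (g : hom Y W) (gf : g \oc f = 0) :
    hom (coker f) W :=
  sval (cid ((cokerP f).2 W g gf)).

Lemma cokerdescE X Y W (f : hom X Y) (g : hom Y W) (gf : g \oc f = 0) :
  cokerdesc gf \oc cokerm f = g.
Proof. by rewrite /cokerdesc; case: cid => h []. Qed.

End AbTheory.

Record functor (S T : zcat) := Functor {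
  fob :> S -> T;
  fmap : forall X Y : S, hom X Y -> hom (fob X) (fob Y);
  fmap1 : forall X : S, fmap (idm X) = idm (fob X);
  fmapM : forall (X Y Z : S) (g : hom Y Z) (f : hom X Y),
    fmap (g \oc f) = fmap g \oc fmap f }.

Arguments fmap {S T} F {X Y} f : rename.

Definition fcompose (S T U : zcat) (G : functor T U) (F : functor S T) :
  functor S U.
Proof.
refine (@Functor S U (fun X => G (F X)) (fun X Y f => fmap G (fmap F f)) _ _).
- by move=> X; rewrite !fmap1.
- by move=> X Y Z g f; rewrite !fmapM.
Defined.

Record adjunction (S T : zcat) (F : functor S T) (G : functor T S) := Adj {
  adj_unit : forall X : S, hom X (G (F X));
  adj_counit : forall Y : T, hom (F (G Y)) Y;
  unit_nat : forall (X X' : S) (f : hom X X'),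
    fmap G (fmap F f) \oc adj_unit X = adj_unit X' \oc f;
  counit_nat : forall (Y Y' : T) (g : hom Y Y'),
    g \oc adj_counit Y = adj_counit Y' \oc fmap F (fmap G g);
  triangleL : forall X : S, adj_counit (F X) \oc fmap F (adj_unit X) = idm (F X);
  triangleR : forall Y : T, fmap G (adj_counit Y) \oc adj_unit (G Y) = idm (G Y) }.

Definition additive_functor (S T : zcat) (F : functor S T) : Prop :=
  forall (X Y : S) (f g : hom X Y), fmap F (f + g) = fmap F f + fmap F g.

(** [is_cokernel f g] says that X -> Y -> Z -> 0 is exact. *)
Definition right_exact_functor (S T : zcat) (F : functor S T) : Prop :=
  additive_functor F /\
  forall (X Y Z : S) (f : hom X Y) (g : hom Y Z),
    is_cokernel f g -> is_cokernel (fmap F f) (fmap F g).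

Definition exact_functor (S T : zcat) (F : functor S T) : Prop :=
  additive_functor F /\
  forall (X Y Z : S) (f : hom X Y) (g : hom Y Z),
    short_exact f g -> short_exact (fmap F f) (fmap F g).

Definition fullsub (S : zcat) (P : S -> Prop) : zcat :=
  @ZCat {X : S | P X} (fun X Y => hom (sval X) (sval Y)) (fun X => idm (sval X))
    (fun X Y Z g f => g \oc f)
    (fun X Y Z T => @cmpA S _ _ _ _)
    (fun X Y => @cmp1m S _ _) (fun X Y => @cmpm1 S _ _)
    (fun X Y Z => @cmpDl S _ _ _) (fun X Y Z => @cmpDr S _ _ _).

Definition incl (S : zcat) (P : S -> Prop) : functor (fullsub P) S :=
  @Functor (fullsub P) S (fun X => sval X) (fun X Y f => f)
    (fun X => erefl) (fun X Y Z g f => erefl).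

Definition restrict (S T : zcat) (F : functor S T) (P : S -> Prop)
    (Q : T -> Prop) (FPQ : forall X : S, P X -> Q (F X)) :
    functor (fullsub P) (fullsub Q) :=
  @Functor (fullsub P) (fullsub Q)
    (fun X => exist Q (F (sval X)) (FPQ (sval X) (svalP X)))
    (fun X Y f => fmap F f)
    (fun X => fmap1 F (sval X)) (fun X Y Z g f => fmapM F g f).

(** Successor and predecessor on [int] that compute on constructors (recall
    that [Negz n] is - n.+1). *)
Definition isucc (i : int) : int :=
  match i with Posz n => Posz n.+1 | Negz 0 => Posz 0 | Negz n.+1 => Negz n end.

Definition ipred (i : int) : int :=
  match i with Posz 0 => Negz 0 | Posz n.+1 => Posz n | Negz n => Negz n.+1 end.

Lemma isuccE i : isucc i = i + 1.
Proof.
case: i => [n|[|n]] //=; first by rewrite -PoszD addn1.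
by rewrite [Negz n.+1]NegzE NegzE -[X in - Posz X + 1]addn1 PoszD opprD addrNK.
Qed.

Lemma ipredK : cancel ipred isucc. Proof. by case=> [[]|]. Qed.

Lemma isuccK : cancel isucc ipred. Proof. by case=> [|[]]. Qed.

Section Complexes.
Variable A : abcat.

Record cpx := Cpx {
  cob :> int -> A;
  cd : forall i : int, hom (cob i) (cob (isucc i));
  cdd : forall i : int, cd (isucc i) \oc cd i = 0;
  cbd : exists n : int, forall i : int, n < i -> is_zero (cob i) }.

Record cmap (X Y : cpx) := Cmap {
  cm :> forall i : int, hom (X i) (Y i);
  cmE : forall i : int, cd Y i \oc cm i = cm (isucc i) \oc cd X i }.

Lemma cmap_eq X Y (f g : cmap X Y) : (forall i, f i = g i) -> f = g.
Proof.
case: f g => [f fE] [g gE] /= fg; have {fg} fg : f = g by apply: functional_extensionality_dep.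
by subst g; congr Cmap; apply: Prop_irrelevance.
Qed.

Section CmapZmod.
Variables X Y : cpx.

HB.instance Definition _ := gen_eqMixin (cmap X Y).
HB.instance Definition _ := gen_choiceMixin (cmap X Y).

Definition cmap0 : cmap X Y.
Proof. by exists (fun i => 0) => i; rewrite cmpm0 cmp0m. Defined.

Definition cmapN (f : cmap X Y) : cmap X Y.
Proof. by exists (fun i => - f i) => i; rewrite cmpmN cmpNm cmE. Defined.

Definition cmapD (f g : cmap X Y) : cmap X Y.
Proof. by exists (fun i => f i + g i) => i; rewrite cmpDr cmpDl !cmE. Defined.

Lemma cmapDA : associative cmapD.
Proof. by move=> f g h; apply: cmap_eq => i; apply: addrA. Qed.
Lemma cmapDC : commutative cmapD.
Proof. by move=> f g; apply: cmap_eq => i; apply: addrC. Qed.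
Lemma cmap0D : left_id cmap0 cmapD.
Proof. by move=> f; apply: cmap_eq => i; apply: add0r. Qed.
Lemma cmapND : left_inverse cmap0 cmapN cmapD.
Proof. by move=> f; apply: cmap_eq => i; apply: addNr. Qed.

HB.instance Definition _ :=
  GRing.isZmodule.Build (cmap X Y) cmapDA cmapDC cmap0D cmapND.

(** The homotopy [h] has components X^(i+1) -> Y^i; as every integer is a
    successor, the equation below is imposed in all degrees. *)
Definition null_homotopic (f : cmap X Y) : Prop :=
  exists h : forall i : int, hom (X (isucc i)) (Y i),
    forall i : int, f (isucc i) = cd Y i \oc h i + h (isucc i) \oc cd X (isucc i).

Definition null_pred : {pred cmap X Y} := fun f => `[< null_homotopic f >].

Lemma null_predP (f : cmap X Y) : reflect (null_homotopic f) (f \in null_pred).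
Proof. exact: asboolP. Qed.

Lemma null_pred_closed : zmod_closed null_pred.
Proof.
split=> [|f g /null_predP[h hE] /null_predP[k kE]]; apply/null_predP.
  by exists (fun i => 0) => i /=; rewrite cmp0m cmpm0 addr0.
exists (fun i => h i - k i) => i /=.
by rewrite hE kE !cmpDl !cmpDr cmpNm cmpmN opprD addrACA.
Qed.

HB.instance Definition _ :=
  GRing.isZmodClosed.Build (cmap X Y) null_pred null_pred_closed.

Definition khom : zmodType := Quotient.quot null_pred.

Definition hcls (f : cmap X Y) : khom := \pi_(Quotient.quot null_pred) f.

Definition hrep (f : khom) : cmap X Y := repr f.

Lemma hrepK (f : khom) : hcls (hrep f) = f.
Proof. exact: reprK. Qed.

Lemma hclsP (f g : cmap X Y) : hcls f = hcls g <-> null_homotopic (f - g).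
Proof.
rewrite /hcls; split=> [/eqP|/null_predP fg].
  by rewrite -Quotient.idealrBE => /null_predP.
by apply/eqP; rewrite -Quotient.idealrBE.
Qed.

Lemma hcls0 : hcls 0 = 0.
Proof. exact: raddf0. Qed.

Lemma hclsN (f : cmap X Y) : hcls (- f) = - hcls f.
Proof. exact: raddfN. Qed.

Lemma hclsD (f g : cmap X Y) : hcls (f + g) = hcls f + hcls g.
Proof. exact: raddfD. Qed.

End CmapZmod.

Definition cmap1 (X : cpx) : cmap X X.
Proof. by exists (fun i => idm (X i)) => i; rewrite cmpm1 cmp1m. Defined.

Definition cmapM (X Y Z : cpx) (g : cmap Y Z) (f : cmap X Y) : cmap X Z.
Proof. by exists (fun i => g i \oc f i) => i; rewrite cmpA cmE -cmpA cmE cmpA. Defined.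

Lemma null_cmapMl X Y Z (g : cmap Y Z) (f : cmap X Y) :
  null_homotopic g -> null_homotopic (cmapM g f).
Proof.
case=> h hE; exists (fun i => h i \oc f (isucc i)) => i /=.
by rewrite hE cmpDl -!cmpA cmE.
Qed.

Lemma null_cmapMr X Y Z (g : cmap Y Z) (f : cmap X Y) :
  null_homotopic f -> null_homotopic (cmapM g f).
Proof.
case=> h hE; exists (fun i => g i \oc h i) => i /=.
by rewrite hE cmpDr !cmpA cmE.
Qed.

Lemma cmapMBl X Y Z (g g' : cmap Y Z) (f : cmap X Y) :
  cmapM g f - cmapM g' f = cmapM (g - g') f.
Proof. by apply: cmap_eq => i /=; rewrite cmpDl cmpNm. Qed.

Lemma cmapMBr X Y Z (g : cmap Y Z) (f f' : cmap X Y) :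
  cmapM g f - cmapM g f' = cmapM g (f - f').
Proof. by apply: cmap_eq => i /=; rewrite cmpDr cmpmN. Qed.

Definition kcmp X Y Z (g : khom Y Z) (f : khom X Y) : khom X Z :=
  hcls (cmapM (hrep g) (hrep f)).

Lemma hclsM X Y Z (g : cmap Y Z) (f : cmap X Y) :
  kcmp (hcls g) (hcls f) = hcls (cmapM g f).
Proof.
transitivity (hcls (cmapM (hrep (hcls g)) f)); apply/hclsP.
  by rewrite cmapMBr; apply/null_cmapMr/hclsP; rewrite hrepK.
by rewrite cmapMBl; apply/null_cmapMl/hclsP; rewrite hrepK.
Qed.

Definition Kminus : zcat.
Proof.
refine (@ZCat cpx khom (fun X => hcls (cmap1 X)) kcmp _ _ _ _ _).
- move=> X Y Z T h g f; rewrite -[h]hrepK -[g]hrepK -[f]hrepK !hclsM.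
  by congr hcls; apply: cmap_eq => i /=; rewrite cmpA.
- move=> X Y f; rewrite -[f]hrepK hclsM.
  by congr hcls; apply: cmap_eq => i /=; rewrite cmp1m.
- move=> X Y f; rewrite -[f]hrepK hclsM.
  by congr hcls; apply: cmap_eq => i /=; rewrite cmpm1.
- move=> X Y Z g g' f; rewrite -[f]hrepK -[g]hrepK -[g']hrepK -hclsD !hclsM -hclsD.
  by congr hcls; apply: cmap_eq => i /=; rewrite cmpDl.
- move=> X Y Z g f f'; rewrite -[f]hrepK -[g]hrepK -[f']hrepK -hclsD !hclsM -hclsD.
  by congr hcls; apply: cmap_eq => i /=; rewrite cmpDr.
Defined.

Definition shift (X : cpx) : cpx.
Proof.
exists (fun i => X (isucc i)) (fun i => - cd X (isucc i)).
- by move=> i; rewrite cmpNm cmpmN cdd !oppr0.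
- have [n nX] := cbd X; exists n => i ni; apply: nX.
  by rewrite isuccE (lt_le_trans ni) // lerDl.
Defined.

(** The corestriction of d^(i-1), whose cokernel is H^i(X). *)
Definition bnd (X : cpx) (i : int) :
    hom (X (ipred i)) (ker (cd X (isucc (ipred i)))) :=
  kerlift (cdd X (ipred i)).

Definition coh (X : cpx) (i : int) : A := coker (bnd X i).

Lemma cocycle_proof X Y (f : cmap X Y) (i : int) :
  cd Y i \oc (f i \oc kerm (cd X i)) = 0.
Proof. by rewrite cmpA cmE -cmpA (kerP _).1 cmpm0. Qed.

Definition cocycle_map X Y (f : cmap X Y) (i : int) :
    hom (ker (cd X i)) (ker (cd Y i)) :=
  kerlift (cocycle_proof f i).

Lemma coh_proof X Y (f : cmap X Y) (i : int) :
  (cokerm (bnd Y i) \oc cocycle_map f (isucc (ipred i))) \oc bnd X i = 0.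
Proof.
have -> : cokerm (bnd Y i) \oc cocycle_map f (isucc (ipred i)) \oc bnd X i =
          cokerm (bnd Y i) \oc bnd Y i \oc f (ipred i).
  rewrite -!cmpA; congr (_ \oc _); apply: kerm_monic.
  by rewrite !cmpA !kerliftE -!cmpA !kerliftE cmE.
by rewrite (cokerP _).1 cmp0m.
Qed.

Definition coh_map X Y (f : cmap X Y) (i : int) : hom (coh X i) (coh Y i) :=
  cokerdesc (coh_proof f i).

(** Homotopic chain maps agree on cohomology, so the representative [g] of the
    homotopy class [f] is immaterial. *)
Definition quasi_iso (X Y : Kminus) (f : hom X Y) : Prop :=
  exists g : cmap X Y, hcls g = f /\ forall i : int, is_iso (coh_map g i).

Definition cpx3_ob (X Y Z : A) (i : int) : A :=
  match i with
  | Posz 0 => Z | Posz _.+1 => zob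
  | Negz 0 => Y | Negz 1 => X | Negz _.+2 => zob
  end.

Definition cpx3_d (X Y Z : A) (f : hom X Y) (g : hom Y Z) (i : int) :
    hom (cpx3_ob X Y Z i) (cpx3_ob X Y Z (isucc i)) :=
  match i with
  | Posz _ => 0
  | Negz 0 => g | Negz 1 => f | Negz _.+2 => 0
  end.

Definition cpx3 (X Y Z : A) (f : hom X Y) (g : hom Y Z) (gf : g \oc f = 0) : cpx.
Proof.
exists (cpx3_ob X Y Z) (cpx3_d f g).
- by case=> [n|[|[|n]]] //=; rewrite ?cmpm0 ?cmp0m.
- by exists 0 => -[[|n]|[|[|n]]] //= _; apply: zobP.
Defined.

Definition tau_ob (X : cpx) (i : int) : A :=
  match i with
  | Posz n => X (Posz n)
  | Negz 0 => X (Negz 0)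
  | Negz 1 => ker (cd X (Negz 0))
  | Negz _.+2 => zob
  end.

Definition tau_d (X : cpx) (i : int) : hom (tau_ob X i) (tau_ob X (isucc i)) :=
  match i with
  | Posz n => cd X (Posz n)
  | Negz 0 => cd X (Negz 0)
  | Negz 1 => kerm (cd X (Negz 0))
  | Negz _.+2 => 0
  end.

Definition tau_cpx (X : cpx) : cpx.
Proof.
exists (tau_ob X) (tau_d X).
- case=> [n|[|[|n]]] /=; first exact: (cdd X (Posz n)).
  + exact: (cdd X (Negz 0)).
  + exact: (kerP _).1.
  + by rewrite cmpm0.
- have [n nX] := cbd X; exists (Num.max n 0) => i; rewrite gt_max => /andP[ni i0].
  by case: i ni i0 => // m nm _; apply: nX.
Defined.

Definition tau_cm X Y (f : cmap X Y) (i : int) : hom (tau_ob X i) (tau_ob Y i) :=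
  match i with
  | Posz n => f (Posz n)
  | Negz 0 => f (Negz 0)
  | Negz 1 => cocycle_map f (Negz 0)
  | Negz _.+2 => 0
  end.

Definition tau_cmap X Y (f : cmap X Y) : cmap (tau_cpx X) (tau_cpx Y).
Proof.
exists (tau_cm f); case=> [n|[|[|n]]] /=.
- exact: (cmE f (Posz n)).
- exact: (cmE f (Negz 0)).
- exact: kerliftE.
- by rewrite !cmpm0.
Defined.

Lemma tau_cmapB X Y (f g : cmap X Y) : tau_cmap (f - g) = tau_cmap f - tau_cmap g.
Proof.
apply: cmap_eq => -[n|[|[|n]]] //=; last by rewrite subrr.
by apply: kerm_monic; rewrite cmpDr cmpmN !kerliftE cmpDl cmpNm.
Qed.

Lemma tau_null X Y (f : cmap X Y) : null_homotopic f -> null_homotopic (tau_cmap f).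
Proof.
case=> h hE.
have dh : cd Y (Negz 0) \oc (cd Y (Negz 1) \oc h (Negz 1)) = 0.
  by rewrite cmpA (cdd Y (Negz 1)) cmp0m.
pose k (i : int) : hom (tau_ob X (isucc i)) (tau_ob Y i) :=
  match i with
  | Posz n => h (Posz n)
  | Negz 0 => h (Negz 0)
  | Negz 1 => kerlift dh
  | Negz _.+2 => 0
  end.
exists k; case=> [n|[|[|[|n]]]] /=.
- exact: (hE (Posz n)).
- exact: (hE (Negz 0)).
- by rewrite kerliftE; apply: (hE (Negz 1)).
- apply: kerm_monic; rewrite kerliftE cmpm0 add0r cmpA kerliftE.
  by rewrite (hE (Negz 1)) cmpDl -!cmpA /= (kerP _).1 cmpm0 addr0.
- by rewrite cmpm0 cmp0m addr0.
Qed.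

Lemma tau_cls X Y (f g : cmap X Y) :
  hcls f = hcls g -> hcls (tau_cmap f) = hcls (tau_cmap g).
Proof. by move=> /hclsP fg; apply/hclsP; rewrite -tau_cmapB; apply: tau_null. Qed.

Definition tau : functor Kminus Kminus.
Proof.
refine (@Functor Kminus Kminus tau_cpx
  (fun X Y (f : khom X Y) => hcls (tau_cmap (hrep f))) _ _).
- move=> X; rewrite (tau_cls (hrepK _)); congr hcls.
  apply: cmap_eq => -[n|[|[|n]]] //=.
    by apply: kerm_monic; rewrite kerliftE cmp1m cmpm1.
  by rewrite zobP.
- move=> X Y Z g f; rewrite (tau_cls (hrepK _)); apply: etrans (esym (hclsM _ _)); congr hcls.
  apply: cmap_eq => -[n|[|[|n]]] //=; last by rewrite cmpm0.
  by apply: kerm_monic; rewrite cmpA !kerliftE /= -!cmpA kerliftE.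
Defined.

(** X and Y below range over K^-(A), so [isom X Y] is homotopy equivalence. *)
Definition leA (X : Kminus) : Prop :=
  exists Y : Kminus, isom X Y /\ forall i : int, 0 < i -> is_zero (cob Y i).

Definition geA (X : Kminus) : Prop :=
  exists Y : Kminus, isom X Y /\
    (forall i : int, i < - 2%:Z -> is_zero (cob Y i)) /\
    is_zero (coh Y (- 2%:Z)) /\ is_zero (coh Y (- 1%:Z)).

Definition inHA (X : Kminus) : Prop := leA X /\ geA X.

Definition HA : zcat := fullsub inHA.

Definition additive_sub (C : A -> Prop) : Prop :=
  C zob /\ forall X Y : A, C X -> C Y -> C (bip X Y).

Definition strictly_full (C : A -> Prop) : Prop :=
  forall X Y : A, isom X Y -> C X -> C Y.

Definition karoubi_closed (C : A -> Prop) : Prop :=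
  forall X Y Z : A, C X -> isom X (bip Y Z) -> C Y.

Variable C : A -> Prop.

Definition C_cover (M D : A) (c : hom D M) : Prop :=
  C D /\ epic c /\
  forall E : A, C E -> forall g : hom E M, exists h : hom E D, c \oc h = g.

Definition inTC (X : Kminus) : Prop := forall i : int, C (cob X i).

Definition TC : zcat := fullsub inTC.

Definition inclTC : functor TC Kminus := incl inTC.

Definition is_approximation (X : Kminus) (XC : TC) (e : hom (inclTC XC) X) : Prop :=
  quasi_iso e /\
  forall Y : TC, bijective (fun f : hom Y XC => e \oc fmap inclTC f).

Definition approximating : Prop :=
  forall X : Kminus, exists (XC : TC) (e : hom (inclTC XC) X), is_approximation e.

Definition leC (X : TC) : Prop := leA (inclTC X).

Definition geC (X : TC) : Prop :=
  forall Y : TC, leC Y ->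
    forall f : @hom Kminus (shift (inclTC Y)) (inclTC X), f = 0.

Definition inHC (X : TC) : Prop := leC X /\ geC X.

Definition HC : zcat := fullsub inHC.

Record approximation (X : Kminus) := Approximation {
  apx_ob : TC;
  apx : hom (inclTC apx_ob) X;
  apxP : is_approximation apx }.

Lemma approximating_choice :
  approximating -> inhabited (forall X : Kminus, approximation X).
Proof.
move=> aC; constructor=> X.
by have [XC /cid[e eP]] := cid (aC X); exists XC e.
Qed.

Variable ch : forall X : Kminus, approximation X.

Lemma apx_lift (X : Kminus) (Y : TC) (f : hom (inclTC Y) X) :
  exists g : hom Y (apx_ob (ch X)), apx (ch X) \oc fmap inclTC g = f.
Proof. by case: ((apxP (ch X)).2 Y) => u _ uK; exists (u f); rewrite uK. Qed.

Lemma apx_inj (X : Kminus) (Y : TC) (g h : hom Y (apx_ob (ch X))) :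
  apx (ch X) \oc fmap inclTC g = apx (ch X) \oc fmap inclTC h -> g = h.
Proof. exact: (bij_inj ((apxP (ch X)).2 Y)). Qed.

Definition pi_map (X Y : Kminus) (f : hom X Y) :
    hom (apx_ob (ch X)) (apx_ob (ch Y)) :=
  sval (cid (apx_lift (f \oc apx (ch X)))).

Lemma pi_mapE (X Y : Kminus) (f : hom X Y) :
  apx (ch Y) \oc fmap inclTC (pi_map f) = f \oc apx (ch X).
Proof. by rewrite /pi_map; case: cid. Qed.

Definition piC : functor Kminus TC.
Proof.
refine (@Functor Kminus TC (fun X => apx_ob (ch X)) pi_map _ _).
- by move=> X; apply: apx_inj; rewrite pi_mapE fmap1 cmp1m cmpm1.
- by move=> X Y Z g f; apply: apx_inj; rewrite pi_mapE fmapM cmpA pi_mapE -!cmpA pi_mapE.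
Defined.

Definition tauTC : functor TC Kminus := fcompose tau inclTC.

Variable htau : forall X : TC, inHC X -> inHA (tauTC X).
Variable hpi : forall X : Kminus, inHA X -> inHC (piC X).

Definition tauH : functor HC HA := restrict htau.
Definition piH : functor HA HC := restrict hpi.

End Complexes.

Section Classes.
Variables (A : abcat) (C : A -> Prop).

Definition classA (G : functor (HA A) (HC C)) (V : HA A) : Prop := is_zero (G V).

(** [exists p, is_cokernel f p] with target [W] says that [W] is isomorphic to
    the cokernel of [f]. *)
Definition classB (F : functor (HC C) (HA A)) (G : functor (HA A) (HC C))
    (adj : adjunction F G) (W : HA A) : Prop :=
  exists (V : HA A) (p : hom V W), is_cokernel (adj_counit adj V) p.

Definition classC (V : HA A) : Prop :=
  exists (X D Y Z : A) (f : hom X (bip D Y)) (g : hom (bip D Y) Z)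
         (gf : g \oc f = 0) (h : inHA (cpx3 gf : Kminus A)),
    C_cover C (g \oc injl D Y) /\
    isom V (exist (@inHA A) (cpx3 gf : Kminus A) h : HA A).

End Classes.

(** The t-structures are given by their aisles [leS] and [leT]. *)
Definition right_t_exact (S T : zcat) (leS : S -> Prop) (leT : T -> Prop)
    (F : functor S T) : Prop :=
  forall X : S, leS X -> leT (F X).

(* Main.v *)
(** For an object E of A placed in degree 0 and a complex X, the group
    X(E) = Hom_{K^-(A)}(E, X) is H^0 of Hom(E, X).  An object X of T_C^{<= 0} is
    homotopy equivalent to a complex of objects of C in degrees <= 0 (the
    contraction of the positive part splits off ker d^0, by Karoubi closedness),
    and then X is the cokernel of X^{-1} -> X^0 as tested on complexes T for which
    Hom(E, T) is acyclic in negative degrees for all E in C: chain maps and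
    homotopies X -> T are built by descending recursion.  Objects of H_C are such
    targets.  The same holds for H_A, with all objects of A in place of those of
    C.  Hence in both hearts a sequence X -> Y -> Z which is right exact when
    evaluated at all E (in C, resp. in A) has Z as cokernel, and a pointwise
    bijective map is an isomorphism.  In H_A the explicit truncated cone shows
    that conversely cokernels are pointwise.

    Since pi_C X and X have the same values on C, pi_C preserves cokernels; it
    preserves kernels as a right adjoint.  The unit X -> pi_C tau X is pointwise
    bijective on C because X -> tau X is the identity in degrees >= -1.  Finally
    pi_C V = 0 iff V(E) = 0 for all E in C; for such V and a C-cover D -> V^0 the
    map D -> V is null-homotopic, so V is isomorphic to its cone, truncated. *)
From mathcomp Require Import all_boot all_order all_algebra.
From mathcomp Require Import boolp.
Require Import Defs.

Set Implicit Arguments.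
Unset Strict Implicit.
Unset Printing Implicit Defensive.

Import Order.TTheory GRing.Theory Num.Theory.
Local Open Scope ring_scope.

(** * Additive and abelian categories *)

(** Used to build chain maps and homotopies one degree at a time; P is the invariant that makes the
    next choice possible. *)
Lemma nat_dependent_choice (T : nat -> Type) (P : forall n, T n -> Prop)
    (R : forall n, T n -> T n.+1 -> Prop) (t0 : T 0) :
    P 0 t0 ->
    (forall n t, P n t -> exists t', P n.+1 t' /\ R n t t') ->
  exists t : forall n, T n, t 0 = t0 /\ forall n, R n (t n) (t n.+1).
Proof.
move=> P0 PS.
pose next n (t : {t | P n t}) : {t' | P n.+1 t'} :=
  let c := cid (PS n (sval t) (svalP t)) in exist _ (sval c) (svalP c).1.
pose seqt := fix F n : {t | P n t} :=
  if n is m.+1 then next m (F m) else exist _ t0 P0.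
exists (fun n => sval (seqt n)); split=> // n /=.
by case: (cid (PS n _ _)) => t' [].
Qed.

Section ZcatLemmas.
Variable S : zcat.
Implicit Types X Y Z : S.

Lemma zero_source X Y (f g : hom X Y) : is_zero X -> f = g.
Proof. by move=> X0; rewrite -(cmpm1 f) -(cmpm1 g) X0 !cmpm0. Qed.

Lemma zero_target X Y (f g : hom X Y) : is_zero Y -> f = g.
Proof. by move=> Y0; rewrite -(cmp1m f) -(cmp1m g) Y0 !cmp0m. Qed.

Lemma cmpBl X Y Z (g g' : hom Y Z) (f : hom X Y) :
  (g - g') \oc f = g \oc f - g' \oc f.
Proof. by rewrite cmpDl cmpNm. Qed.

Lemma cmpBr X Y Z (g : hom Y Z) (f f' : hom X Y) :
  g \oc (f - f') = g \oc f - g \oc f'.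
Proof. by rewrite cmpDr cmpmN. Qed.

Lemma isom_refl X : isom X X.
Proof. by exists (idm X), (idm X); rewrite cmp1m. Qed.

Lemma isom_sym X Y : isom X Y -> isom Y X.
Proof. by case=> f [g [gf fg]]; exists g, f. Qed.

Lemma isom_trans X Y Z : isom X Y -> isom Y Z -> isom X Z.
Proof.
case=> f [f' [f'f ff']] [g [g' [g'g gg']]].
exists (g \oc f), (f' \oc g'); split.
  by rewrite cmpA -(cmpA f') g'g cmpm1.
by rewrite cmpA -(cmpA g) ff' cmpm1.
Qed.

Lemma is_iso_comp X Y Z (g : hom Y Z) (f : hom X Y) :
  is_iso g -> is_iso f -> is_iso (g \oc f).
Proof.
case=> g' [g'g gg'] [f' [f'f ff']]; exists (f' \oc g'); split.
  by rewrite cmpA -(cmpA f') g'g cmpm1.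
by rewrite cmpA -(cmpA g) ff' cmpm1.
Qed.

Lemma is_cokernel_epic X Y Z (f : hom X Y) (c : hom Y Z) :
  is_cokernel f c -> epic c.
Proof.
case=> cf0 cok W g h gh; have [|u [_ uu]] := cok W (g \oc c).
  by rewrite -cmpA cf0 cmpm0.
by rewrite -(uu g erefl) -(uu h (esym gh)).
Qed.

End ZcatLemmas.

Lemma fmap_isom (S T : zcat) (F : functor S T) (X Y : S) :
  isom X Y -> isom (F X) (F Y).
Proof.
case=> f [g [gf fg]]; exists (fmap F f), (fmap F g).
by rewrite -!fmapM gf fg !fmap1.
Qed.

(** Expresses a cokernel of a full subcategory by morphisms of the ambient category. *)
Definition cokernel_in (S : zcat) (P : S -> Prop) (X Y Z : S) (f : hom X Y)
    (g : hom Y Z) : Prop :=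
  g \oc f = 0 /\ forall W, P W -> forall w : hom Y W, w \oc f = 0 ->
    exists! v : hom Z W, v \oc g = w.

Lemma fullsub_cokernel (S : zcat) (P : S -> Prop) (X Y Z : fullsub P)
    (f : @hom S (sval X) (sval Y)) (g : @hom S (sval Y) (sval Z)) :
  @is_cokernel (fullsub P) X Y Z f g <-> cokernel_in P f g.
Proof.
split=> -[gf gu]; split=> //; last by move=> W; apply: gu (svalP W).
by move=> W PW; apply: (gu (exist _ W PW)).
Qed.

Lemma fullsub_isom (S : zcat) (P : S -> Prop) (X Y : fullsub P) :
  isom X Y -> @isom S (sval X) (sval Y).
Proof. by []. Qed.

Lemma fullsub_fullsub_cokernel (S : zcat) (Q : S -> Prop)
    (P : fullsub Q -> Prop) (X Y Z : fullsub P)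
    (f : @hom S (sval (sval X)) (sval (sval Y)))
    (g : @hom S (sval (sval Y)) (sval (sval Z))) :
  cokernel_in (fun W => exists h : Q W, P (exist _ W h)) f g ->
  @is_cokernel (fullsub P) X Y Z f g.
Proof.
case=> gf gu; apply/fullsub_cokernel; split=> // -[W QW] PW.
by apply: gu; exists QW.
Qed.

Section AbelianLemmas.
Variable A : abcat.
Implicit Types X Y Z : A.

Lemma coker_zero X Y (f : hom X Y) : cokerm f = 0 -> is_zero (coker f).
Proof.
move=> c0; apply: (is_cokernel_epic (cokerP f)).
by rewrite c0 !cmpm0.
Qed.

Lemma coker_zero_epic X Y (f : hom X Y) : is_zero (coker f) -> epic f.
Proof.
move=> c0 W g h gh; have gh0 : (g - h) \oc f = 0 by rewrite cmpBl gh subrr.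
by apply/eqP; rewrite -subr_eq0 -(cokerdescE gh0) (zero_target (cokerm f) 0 c0) cmpm0.
Qed.

(** f is the kernel of some g, and g = 0 because f is epic; hence the identity of Y factors through
    f. *)
Lemma monic_epic_section X Y (f : hom X Y) :
  monic f -> epic f -> exists g, f \oc g = idm Y.
Proof.
move=> fm fe; have [Z [g [gf0 gk]]] := monic_normal fm.
have g0 : g = 0 by apply: fe; rewrite gf0 cmp0m.
by have [|h [hE _]] := gk _ (idm Y); [rewrite g0 cmp0m | exists h].
Qed.

Lemma monic_ker_zero X Y (f : hom X Y) : monic f -> is_zero (ker f).
Proof.
move=> fm; apply: (@kerm_monic A _ _ f); rewrite cmpm0 cmpm1.
by apply: fm; rewrite (kerP f).1 cmpm0.
Qed.

Lemma ker_zero_monic X Y (f : hom X Y) : is_zero (ker f) -> monic f.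
Proof.
move=> k0 W g h gh; have gh0 : f \oc (g - h) = 0 by rewrite cmpBr gh subrr.
by apply/eqP; rewrite -subr_eq0 -(kerliftE gh0) (zero_source (kerm f) 0 k0) cmp0m.
Qed.

Lemma retract_isom X Y (i : hom Y X) (r : hom X Y) :
  r \oc i = idm Y -> isom X (bip Y (ker r)).
Proof.
move=> ri; have rk : r \oc (idm X - i \oc r) = 0.
  by rewrite cmpBr cmpm1 cmpA ri cmp1m subrr.
have lk : kerlift rk \oc kerm r = idm (ker r).
  apply: kerm_monic; rewrite cmpA kerliftE cmpBl cmp1m -cmpA (kerP r).1.
  by rewrite cmpm0 subr0 cmpm1.
have li : kerlift rk \oc i = 0.
  by apply: kerm_monic; rewrite cmpA kerliftE cmpBl cmp1m -cmpA ri cmpm1 subrr cmpm0.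
exists (injl _ _ \oc r + injr _ _ \oc kerlift rk).
exists (i \oc prl _ _ + kerm r \oc prr _ _); split.
  rewrite cmpDl !cmpDr -!cmpA !(cmpA (prl _ _)) !(cmpA (prr _ _)).
  rewrite prl_injl prr_injr prl_injr prr_injl !cmp0m !cmp1m !cmpm0 addr0 add0r.
  by rewrite kerliftE addrC subrK.
rewrite cmpDl !cmpDr -!cmpA !(cmpA r) !(cmpA (kerlift rk)).
by rewrite ri lk li (kerP r).1 !cmp0m !cmp1m !cmpm0 addr0 add0r bipE.
Qed.

End AbelianLemmas.

Lemma fmap_0 (S T : zcat) (F : functor S T) (X Y : S) :
  additive_functor F -> fmap F (0 : hom X Y) = 0.
Proof. by move=> Fadd; apply: (addrI (fmap F 0)); rewrite -Fadd !addr0. Qed.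

Lemma restrict_additive (S T : zcat) (F : functor S T) (P : S -> Prop)
    (Q : T -> Prop) (FPQ : forall X : S, P X -> Q (F X)) :
  additive_functor F -> additive_functor (restrict FPQ).
Proof. by move=> Fadd X Y f g; apply: Fadd. Qed.

Lemma fcompose_incl_additive (S T : zcat) (F : functor S T) (P : S -> Prop) :
  additive_functor F -> additive_functor (fcompose F (incl P)).
Proof. by move=> Fadd X Y f g; apply: Fadd. Qed.

(** * Exactness properties of adjoint functors *)

Section Adjunctions.
Variables (S T : zcat) (F : functor S T) (G : functor T S).

Lemma left_adjoint_right_exact :
  additive_functor F -> additive_functor G -> inhabited (adjunction F G) ->
  right_exact_functor F.
Proof.
move=> Fadd Gadd [adj]; split=> // X Y Z f g [gf gu].
split=> [|W w wf]; first by rewrite -fmapM gf fmap_0.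
have [|v [vg vu]] := gu (G W) (fmap G w \oc adj_unit adj Y).
  by rewrite -cmpA -unit_nat cmpA -fmapM wf fmap_0 // cmp0m.
exists (adj_counit adj W \oc fmap F v); split=> [|u uE].
  rewrite -cmpA -fmapM vg fmapM cmpA -counit_nat -cmpA triangleL.
  exact: cmpm1.
rewrite (vu (fmap G u \oc adj_unit adj Z)); last first.
  by rewrite -cmpA -unit_nat cmpA -fmapM uE.
by rewrite fmapM cmpA -counit_nat -cmpA triangleL cmpm1.
Qed.

Lemma right_adjoint_kernel (X Y Z : T) (f : hom Y Z) (k : hom X Y) :
  additive_functor F -> additive_functor G -> adjunction F G ->
  is_kernel f k -> is_kernel (fmap G f) (fmap G k).
Proof.
move=> Fadd Gadd adj [fk ku]; split=> [|W w fw].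
  by rewrite -fmapM fk fmap_0.
have [|u [uE uu]] := ku (F W) (adj_counit adj Y \oc fmap F w).
  by rewrite cmpA counit_nat -cmpA -fmapM fw fmap_0 // cmpm0.
exists (fmap G u \oc adj_unit adj W); split=> [|v vE].
  rewrite cmpA -fmapM uE fmapM -cmpA unit_nat cmpA triangleR.
  exact: cmp1m.
rewrite (uu (adj_counit adj X \oc fmap F v)).
  by rewrite fmapM -cmpA unit_nat cmpA triangleR cmp1m.
by rewrite cmpA counit_nat -cmpA -fmapM vE.
Qed.

(** If G W = 0, the counit at W has zero source and cokernel W. Conversely G p is epic and kills G
    of the counit, which is split epic by a triangle identity; so G p = 0 and its target
    vanishes. *)
Lemma zero_iff_coker_counit (adj : adjunction F G) (W : T) :
    additive_functor F ->
    (forall (X Y Z : T) (f : hom X Y) (g : hom Y Z),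
       is_cokernel f g -> is_cokernel (fmap G f) (fmap G g)) ->
  is_zero (G W) <->
  exists (V : T) (p : hom V W), is_cokernel (adj_counit adj V) p.
Proof.
move=> Fadd Gcok; split=> [W0|[V [p pcok]]].
  have FW0 : is_zero (F (G W)) by rewrite /is_zero -fmap1 W0 fmap_0.
  exists W, (idm W); split=> [|U g _].
    exact: (zero_source _ _ FW0).
  by exists g; split=> [|h]; rewrite cmpm1.
apply: (is_cokernel_epic (Gcok _ _ _ _ _ pcok)).
have [Gp0 _] := Gcok _ _ _ _ _ pcok.
suff -> : fmap G p = 0 by rewrite !cmpm0.
by rewrite -(cmpm1 (fmap G p)) -(triangleR adj) cmpA Gp0 cmp0m.
Qed.

End Adjunctions.

Lemma adj_unit_inj (S T : zcat) (F : functor S T) (G : functor T S)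
    (adj : adjunction F G) X Y (u v : hom (F X) Y) :
  fmap G u \oc adj_unit adj X = fmap G v \oc adj_unit adj X -> u = v.
Proof.
move=> uv; rewrite -(cmpm1 u) -(cmpm1 v) -(triangleL adj) !cmpA !counit_nat.
by rewrite -!cmpA -!fmapM uv.
Qed.

(** The units of two adjunctions between F and G differ by G of an automorphism [t] of F X, so
    checking a single adjunction suffices. *)
Lemma adj_unit_iso (S T : zcat) (F : functor S T) (G : functor T S)
    (adj adj' : adjunction F G) X :
  is_iso (adj_unit adj' X) -> is_iso (adj_unit adj X).
Proof.
pose t (a b : adjunction F G) : hom (F X) (F X) :=
  adj_counit b (F X) \oc fmap F (adj_unit a X).
have tE (a b : adjunction F G) : fmap G (t a b) \oc adj_unit b X = adj_unit a X.
  by rewrite fmapM -cmpA unit_nat cmpA triangleR cmp1m.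
have tK a b : t a b \oc t b a = idm _.
  by apply: (@adj_unit_inj _ _ _ _ a); rewrite fmapM -cmpA !tE fmap1 cmp1m.
move=> u_iso; rewrite -(tE adj adj'); apply: is_iso_comp u_iso.
by exists (fmap G (t adj' adj)); rewrite -!fmapM !tK !fmap1.
Qed.

(** * Truncations and objects in degree 0 in K^-(A) *)

Section HomotopyCategory.
Variable A : abcat.
Notation K := (Kminus A).
Implicit Types (X Y Z T : cpx A) (E : A) (P : A -> Prop).

(** The homotopy class typed as a morphism of K, so that [\oc] and its lemmas apply. *)
Definition kh X Y (f : cmap X Y) : @hom K X Y := hcls f.

Lemma khP X Y (f : @hom K X Y) : exists g, f = kh g.
Proof. by exists (hrep f); rewrite /kh hrepK. Qed.

Lemma khM X Y Z (g : cmap Y Z) (f : cmap X Y) : kh g \oc kh f = kh (cmapM g f).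
Proof. exact: hclsM. Qed.

Lemma kh_eq X Y (f g : cmap X Y) : (forall i, f i = g i) -> kh f = kh g.
Proof. by move=> fg; congr kh; apply: cmap_eq. Qed.

Lemma kh_eq0 X Y (f : cmap X Y) : kh f = 0 <-> null_homotopic f.
Proof. by rewrite /kh -hcls0 hclsP subr0. Qed.

Lemma khE X Y (f g : cmap X Y) : kh f = kh g <-> null_homotopic (f - g).
Proof. exact: hclsP. Qed.

Definition le0 X : Prop := forall n, is_zero (X (Posz n.+1)).

Lemma leAP X : leA (X : K) <-> exists Y, @isom K X Y /\ le0 Y.
Proof.
split=> [] [Y [XY Y0]]; exists Y; split=> //; first by move=> n; apply: Y0.
by case=> // -[|n] // _; apply: Y0.
Qed.

Lemma leA_isom X Y : @isom K X Y -> leA (X : K) -> leA (Y : K).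
Proof.
move=> XY [Z [XZ Z0]]; exists Z; split=> //.
exact: isom_trans (isom_sym XY) XZ.
Qed.

Lemma isom_homotopy X Y : @isom K X Y ->
  exists (f : cmap X Y) (g : cmap Y X), null_homotopic (cmapM g f - cmap1 X).
Proof.
case=> f [g [gf _]]; have [f0 fE] := khP f; have [g0 gE] := khP g.
by exists f0, g0; apply/khE; rewrite -khM -fE -gE gf.
Qed.

(** [sig X] is the stupid truncation of X in degrees > 0. *)
Definition sig_ob X (i : int) : A :=
  match i with Posz n.+1 => X (Posz n.+1) | _ => zob end.

Definition sig_d X (i : int) : hom (sig_ob X i) (sig_ob X (isucc i)) :=
  match i with Posz n.+1 => cd X (Posz n.+1) | _ => 0 end.

Definition sig X : cpx A.
Proof.
exists (sig_ob X) (sig_d X).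
  by case=> [[|n]|n] /=; rewrite ?cmpm0 //; apply: (cdd X (Posz n.+1)).
have [n nX] := cbd X; exists (Num.max n 0) => i; rewrite gt_max => /andP[ni i0].
by case: i ni i0 => // -[|m] // nm _; apply: nX.
Defined.

Definition sig_incl_cm X (i : int) : hom (sig X i) (X i) :=
  match i with Posz n.+1 => idm (X (Posz n.+1)) | _ => 0 end.

Definition sig_incl X : cmap (sig X) X.
Proof.
exists (sig_incl_cm X); case=> [[|n]|n] /=; last exact: (zero_source _ _ (zobP A)).
  exact: (zero_source _ _ (zobP A)).
by rewrite cmp1m cmpm1.
Defined.

Lemma hom_sig_le0 X Y (f : @hom K (sig X) Y) : le0 Y -> f = 0.
Proof.
move=> Y0; have [g ->] := khP f; rewrite -(_ : kh 0 = 0); last exact: hcls0.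
apply: kh_eq => -[[|n]|n]; last exact: (zero_source _ _ (zobP A)).
  exact: (zero_source _ _ (zobP A)).
exact: (zero_target _ _ (Y0 n)).
Qed.

Lemma hom_sig_leA X Y (f : @hom K (sig X) Y) : leA (Y : K) -> f = 0.
Proof.
case/leAP=> Z [[g [h [hg _]]] Z0].
by rewrite -(cmp1m f) -hg -cmpA (hom_sig_le0 (g \oc f) Z0) cmpm0.
Qed.

Definition trle_ob X (i : int) : A :=
  match i with
  | Posz 0 => ker (cd X (Posz 0)) | Posz n.+1 => zob | Negz n => X (Negz n)
  end.

Definition trle_d X (i : int) : hom (trle_ob X i) (trle_ob X (isucc i)) :=
  match i with
  | Posz n => 0
  | Negz 0 => kerlift (cdd X (Negz 0))
  | Negz n.+1 => cd X (Negz n.+1)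
  end.

Definition trle X : cpx A.
Proof.
exists (trle_ob X) (trle_d X).
  case=> [n|[|[|n]]] /=; rewrite ?cmp0m //; last exact: (cdd X (Negz n.+2)).
  by apply: kerm_monic; rewrite cmpA kerliftE cmpm0; apply: (cdd X (Negz 1)).
by exists 0 => -[[|n]|] // _; apply: zobP.
Defined.

Lemma trle_le0 X : le0 (trle X).
Proof. by move=> n; apply: zobP. Qed.

Definition trle_incl_cm X (i : int) : hom (trle X i) (X i) :=
  match i with
  | Posz 0 => kerm (cd X (Posz 0)) | Posz n.+1 => 0 | Negz n => idm (X (Negz n))
  end.

Definition trle_incl X : cmap (trle X) X.
Proof.
exists (trle_incl_cm X); case=> [[|n]|[|n]] /=.
- by rewrite (kerP _).1 cmpm0.
- by rewrite !cmpm0.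
- by rewrite cmpm1 kerliftE.
- by rewrite cmpm1 cmp1m.
Defined.

(** The lowest component [h 0] yields a retraction of X^0 onto the kernel of d^0
    ([trle_retr]). *)
Definition pos_contraction X (h : forall n, hom (X (Posz n.+1)) (X (Posz n))) :
    Prop :=
  forall n, idm (X (Posz n.+1)) =
    cd X (Posz n) \oc h n + h n.+1 \oc cd X (Posz n.+1).

Lemma sig_incl_null X : kh (sig_incl X) = 0 -> exists h, @pos_contraction X h.
Proof.
case/kh_eq0=> h hE; exists (fun n => h (Posz n)) => n.
exact: (hE (Posz n)).
Qed.

Section Retract.
Variables (X : cpx A) (h : forall n, hom (X (Posz n.+1)) (X (Posz n))).
Hypothesis hX : pos_contraction h.

(** Composing the contraction identity in degree 1 with d^0 gives d^0 h_0 d^0 = d^0. *)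
Lemma trle_proof :
  cd X (Posz 0) \oc (idm (X (Posz 0)) - h 0 \oc cd X (Posz 0)) = 0.
Proof.
have := hX 0; move/(congr1 (fun u => u \oc cd X (Posz 0))).
rewrite cmp1m cmpDl -!cmpA (cdd X (Posz 0)) cmpm0 addr0 => dE.
by rewrite cmpBr cmpm1 -dE subrr.
Qed.

Definition trle_retr : hom (X (Posz 0)) (ker (cd X (Posz 0))) :=
  kerlift trle_proof.

Lemma trle_retrK : trle_retr \oc kerm (cd X (Posz 0)) = idm _.
Proof.
apply: kerm_monic; rewrite cmpA kerliftE cmpBl cmp1m -cmpA (kerP _).1.
by rewrite cmpm0 subr0 cmpm1.
Qed.

Definition trle_proj_cm (i : int) : hom (X i) (trle X i) :=
  match i with
  | Posz 0 => trle_retr | Posz n.+1 => 0 | Negz n => idm (X (Negz n))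
  end.

Definition trle_proj : cmap X (trle X).
Proof.
exists trle_proj_cm; case=> [n|[|n]] /=.
- by rewrite !cmp0m.
- apply: kerm_monic; rewrite cmpm1 !cmpA !kerliftE cmpBl cmp1m -cmpA.
  by rewrite (cdd X (Negz 0)) cmpm0 subr0.
- by rewrite cmpm1 cmp1m.
Defined.

Lemma trle_isom : @isom K X (trle X).
Proof.
exists (kh trle_proj), (kh (trle_incl X)); split; rewrite khM; last first.
  apply: kh_eq => -[[|n]|n] /=; [exact: trle_retrK| |by rewrite cmp1m].
  exact: (zero_source _ _ (zobP A)).
(* The minus sign appears because the map to be contracted is the projection minus the identity. *)
apply/khE; pose k (i : int) : hom (X (isucc i)) (X i) :=
  match i with Posz n => - h n | Negz n => 0 end.
exists k; case=> [n|[|n]] /=.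
- by rewrite cmp0m sub0r (hX n) cmpmN cmpNm opprD.
- by rewrite cmpm0 add0r kerliftE addrAC subrr add0r cmpNm.
- by rewrite cmpm0 cmp0m add0r cmp1m subrr.
Qed.

End Retract.

Lemma sig_incl_null_leA X : kh (sig_incl X) = 0 -> leA (X : K).
Proof.
case/sig_incl_null=> h hX; apply/leAP; exists (trle X).
by split; [apply: trle_isom hX | apply: trle_le0].
Qed.

(** X is homotopy equivalent to a complex that vanishes where [sig X] lives, so [sig X] -> X is
    null-homotopic; a null homotopy contracts the positive part of X and makes ker d^0 a summand of
    X^0. *)
Lemma leA_strict P X : additive_sub P -> karoubi_closed P ->
    (forall i, P (X i)) -> leA (X : K) ->
  exists Y, [/\ @isom K X Y, le0 Y & forall i, P (Y i)].
Proof.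
move=> [P0 _] Pk XP leX; have := hom_sig_leA (kh (sig_incl X)) leX.
case/sig_incl_null=> h hX; exists (trle X); split.
- exact: trle_isom hX.
- exact: trle_le0.
- by case=> [[|n]|n] //=; apply: Pk (XP (Posz 0)) (retract_isom (trle_retrK hX)).
Qed.

(** E in degree 0, encoded by [cpx3] so that the components reduce by computation. *)
Definition sgl E : cpx A := cpx3 (cmpm0 zob (0 : hom (zob : A) E)).

Lemma sgl_le0 E : le0 (sgl E).
Proof. by move=> n; apply: zobP. Qed.

Definition sgl_cm E X (a : hom E (X (Posz 0))) (i : int) : hom (sgl E i) (X i) :=
  match i with Posz 0 => a | _ => 0 end.

Definition sgl_map E X (a : hom E (X (Posz 0))) (da : cd X (Posz 0) \oc a = 0) :
  cmap (sgl E) X.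
Proof.
exists (sgl_cm a); case=> [[|n]|[|[|n]]] /=; rewrite ?cmpm0 ?cmp0m ?da //.
Defined.

Lemma sgl_homP E X (z : @hom K (sgl E) X) :
  exists a da, z = kh (@sgl_map E X a da).
Proof.
have [g ->] := khP z; have da : cd X (Posz 0) \oc g (Posz 0) = 0.
  by rewrite (cmE g (Posz 0)) /= cmpm0.
exists (g (Posz 0)), da; apply: kh_eq => -[[|n]|[|[|n]]] //=;
  exact: (zero_source _ _ (zobP A)).
Qed.

(** Only the component E -> X^{-1} of a homotopy out of [sgl E] can be nonzero. Together with
    [sgl_homP] this identifies morphisms out of [sgl E] with H^0 of Hom(E, X). *)
Lemma sgl_map_eq E X (a b : hom E (X (Posz 0))) da db :
  kh (@sgl_map E X a da) = kh (@sgl_map E X b db) <->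
  exists s : hom E (X (Negz 0)), a - b = cd X (Negz 0) \oc s.
Proof.
split=> [/khE[h hE]|[s sE]].
  by exists (h (Negz 0)); have := hE (Negz 0); rewrite /= cmpm0 addr0.
apply/khE; pose k (i : int) : hom (sgl E (isucc i)) (X i) :=
  match i return hom (sgl E (isucc i)) (X i) with Negz 0 => s | _ => 0 end.
exists k; case=> [n|[|[|n]]] /=; rewrite ?cmpm0 ?cmp0m ?subrr ?addr0 //.
Qed.

Lemma sgl_map_eq0 E X (a : hom E (X (Posz 0))) da :
  kh (@sgl_map E X a da) = 0 <->
  exists s : hom E (X (Negz 0)), a = cd X (Negz 0) \oc s.
Proof.
have -> : (0 : @hom K (sgl E) X) = kh (sgl_map (cmpm0 E (cd X (Posz 0)))).
  rewrite -(_ : kh 0 = 0); last exact: hcls0.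
  by apply: kh_eq => -[[|n]|[|[|n]]].
by rewrite sgl_map_eq subr0.
Qed.

Lemma sgl_mapM_proof E X Y (f : cmap X Y) (a : hom E (X (Posz 0))) :
  cd X (Posz 0) \oc a = 0 -> cd Y (Posz 0) \oc (f (Posz 0) \oc a) = 0.
Proof. by move=> da; rewrite cmpA cmE -cmpA da cmpm0. Qed.

Lemma sgl_mapM E X Y (f : cmap X Y) (a : hom E (X (Posz 0))) da :
  kh f \oc kh (@sgl_map E X a da) = kh (sgl_map (@sgl_mapM_proof E X Y f a da)).
Proof. by rewrite khM; apply: kh_eq => -[[|n]|[|[|n]]] //=; rewrite cmpm0. Qed.

Lemma le0_cd0 X E (a : hom E (X (Posz 0))) : le0 X -> cd X (Posz 0) \oc a = 0.
Proof. by move=> X0; apply: (zero_target _ _ (X0 0)). Qed.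

End HomotopyCategory.

(** * Presentations in the hearts *)

Section NegativeAcyclicity.
Variable A : abcat.
Notation K := (Kminus A).
Implicit Types (X Y Z T : cpx A) (E : A) (P : A -> Prop).

Definition neg_acyclic P T : Prop :=
  forall E, P E -> forall n (g : hom E (T (Negz n))), cd T (Negz n) \oc g = 0 ->
  exists h : hom E (T (Negz n.+1)), cd T (Negz n.+1) \oc h = g.

Lemma neg_acyclic_isom P X Y :
  @isom K X Y -> neg_acyclic P X -> neg_acyclic P Y.
Proof.
move=> /isom_sym/isom_homotopy[f [g [h hE]]] Xac E PE n y dy.
have [|k kE] := Xac E PE n (f (Negz n) \oc y).
  by rewrite cmpA cmE -cmpA dy cmpm0.
(* As gf - 1 = dh + hd and dy = 0, the term h y corrects the boundary of g k from g f y to y. *)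
exists (g (Negz n.+1) \oc k - h (Negz n.+1) \oc y).
rewrite cmpBr cmpA cmE -cmpA kE !cmpA.
have /eqP := hE (Negz n.+1); rewrite /= subr_eq => /eqP ->.
by rewrite !cmpDl -[X in _ + X + _ - _]cmpA dy cmpm0 addr0 cmp1m addrC addKr.
Qed.

Definition sgl_at (i : int) E : cpx A.
Proof.
exists (fun j => if j == i then E else zob) (fun j => 0).
  by move=> j; rewrite cmp0m.
by exists i => j ij; rewrite gt_eqF //; apply: zobP.
Defined.

(** Extension of g by zero; the type of g depends on the degree, hence the transport along j = i. *)
Definition concentrated_cm X Y (i : int) (g : hom (X i) (Y i)) (j : int) :
    hom (X j) (Y j) :=
  match @eqP _ j i with
  | ReflectT e => eq_rect_r (fun j => hom (X j) (Y j)) g e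
  | ReflectF _ => 0
  end.

Lemma concentrated_cmE X Y i (g : hom (X i) (Y i)) : concentrated_cm g i = g.
Proof. by rewrite /concentrated_cm; case: eqP => // e; rewrite (eq_axiomK e). Qed.

Lemma concentrated_map X Y (i : int) (g : hom (X i) (Y i)) :
    (forall j, j != i -> is_zero (X j)) -> cd Y i \oc g = 0 ->
  exists f : cmap X Y, f i = g.
Proof.
move=> X0 dg; suff fE j : cd Y j \oc concentrated_cm g j =
    concentrated_cm g (isucc j) \oc cd X j.
  by exists (Cmap fE); apply: concentrated_cmE.
case: (eqVneq j i) => [-> | ji]; last exact/zero_source/X0.
rewrite concentrated_cmE dg (zero_target (cd X i) 0) ?cmpm0 //.
by apply: X0; rewrite isuccE -subr_eq0 addrC addrA addNr add0r.
Qed.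

(** A cocycle E -> X^{-n-1} is a chain map from the shift of E placed in degree -n, which lies in
    the aisle. This map vanishes by [geC], and a null homotopy provides the primitive. *)
Lemma geC_neg_acyclic P (X : TC P) : P zob -> geC X -> neg_acyclic P (sval X).
Proof.
move=> P0 Xge E PE n g dg.
have YP : @inTC A P (sgl_at (isucc (Negz n)) E) by move=> j /=; case: eqP.
have leY : leC (exist _ _ YP : TC P).
  apply/leAP; exists (sgl_at (isucc (Negz n)) E); split; first exact: isom_refl.
  by move=> m /=; case: n {g dg YP} => [|n] /=; apply: zobP.
pose Q : cpx A := shift (sgl_at (isucc (Negz n)) E).
have QE : Q (Negz n) = E by rewrite /= eqxx.
(* The component of Q equals E only propositionally; u and v carry out the transport. *)
have [u [v [vu _]]] : isom E (Q (Negz n)) by rewrite QE; apply: isom_refl.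
have [||f fE] := @concentrated_map Q (sval X) (Negz n) (g \oc v).
- move=> j jn; change (is_zero (if isucc j == isucc (Negz n) then E else zob)).
  by rewrite (inj_eq (can_inj isuccK)) (negPf jn); apply: zobP.
- by rewrite cmpA dg cmp0m.
have /kh_eq0[h hE] : kh f = 0 by apply: (Xge _ leY).
exists (h (Negz n.+1) \oc u).
have := hE (Negz n.+1); rewrite /= fE oppr0 cmpm0 addr0 => gv.
by rewrite cmpA -gv -cmpA vu cmpm1.
Qed.

(** The kernel d^{-2} is monic, which kills H^{-2}; its factorization property splits [bnd] in
    degree -1, which kills H^{-1}. *)
Lemma geA_kernel X : (forall n, is_zero (X (Negz n.+2))) ->
  is_kernel (cd X (Negz 0)) (cd X (Negz 1)) -> geA (X : K).
Proof.
move=> X0 [d0 kX].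
have dm : monic (cd X (Negz 1)).
  move=> W g h gh; have [|u [_ uu]] := kX W (cd X (Negz 1) \oc g).
    by rewrite cmpA d0 cmp0m.
  by rewrite -(uu g erefl) -(uu h (esym gh)).
exists X; split; first exact: isom_refl.
split; first by case=> // -[|[|n]] // _; apply: X0.
split; apply: coker_zero.
  by apply: zero_source; apply: (monic_ker_zero dm).
have [k [kE _]] := kX _ _ (kerP (cd X (Negz 0))).1.
have bk : bnd X (Negz 0) \oc k = idm _.
  by apply: kerm_monic; rewrite cmpA kerliftE kE cmpm1.
by rewrite -(cmpm1 (cokerm (bnd X (- 1)))) -bk cmpA (cokerP _).1 cmp0m.
Qed.

(** No projectivity of E is required: in the representative Y the map Y^{-2} -> ker d^{-1} is monic
    and epic, so it has a section along which cocycles lift. In degree -2 cocycles vanish since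
    d^{-2} is monic. *)
Lemma geA_neg_acyclic P X : geA (X : K) -> neg_acyclic P X.
Proof.
case=> Y [XY [Y0 [H2 H1]]]; apply: neg_acyclic_isom (isom_sym XY) _.
have Y3 n : is_zero (Y (Negz n.+2)) by apply: Y0.
have dm : monic (cd Y (Negz 1)).
  apply: ker_zero_monic; apply: (coker_zero_epic H2).
  exact: zero_source (Y3 0).
move=> E _ [|[|n]] g dg; last by exists 0; apply/zero_target/Y3.
- have bm : monic (bnd Y (Negz 0)).
    move=> W a b ab; apply: dm; rewrite -(kerliftE (cdd Y (Negz 1))).
    by rewrite -!cmpA; congr (_ \oc _).
  have [k bk] := monic_epic_section bm (coker_zero_epic H1).
  exists (k \oc kerlift dg).
  rewrite cmpA -[cd Y (Negz 1)](kerliftE (cdd Y (Negz 1))) -(cmpA (kerm _)).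
  by rewrite bk cmpm1 kerliftE.
- by exists 0; rewrite cmpm0; apply: dm; rewrite dg cmpm0.
Qed.

(** X is a cokernel of a map sgl E1 -> sgl E0, as tested on negatively acyclic
    targets, and sgl E is projective relative to sgl E0 -> X. *)
Definition presented P X : Prop :=
  exists E1 E0 (d : @hom K (sgl E1) (sgl E0)) (q : @hom K (sgl E0) X),
  [/\ P E1, P E0, q \oc d = 0,
      forall E (z : @hom K (sgl E) X), exists m, q \oc m = z &
      forall T, neg_acyclic P T -> forall t : @hom K (sgl E0) T,
        t \oc d = 0 -> exists! v : @hom K X T, v \oc q = t].

Section ComparisonMap.
Variables (P : A -> Prop) (X T : cpx A).
Hypotheses (XP : forall i, P (X i)) (X0 : le0 X) (Tac : neg_acyclic P T).

Lemma extend_cmap (a : hom (X (Posz 0)) (T (Posz 0)))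
    (b : hom (X (Negz 0)) (T (Negz 0))) :
    cd T (Posz 0) \oc a = 0 -> cd T (Negz 0) \oc b = a \oc cd X (Negz 0) ->
  exists f : cmap X T, f (Posz 0) = a.
Proof.
move=> da db.
(* The invariant says that t composed with the incoming differential of X is a cocycle of T, which
   acyclicity then lifts. *)
have [||v [v0 vE]] := @nat_dependent_choice (fun n => hom (X (Negz n)) (T (Negz n)))
  (fun n t => (cd T (Negz n) \oc t) \oc cd X (Negz n.+1) = 0)
  (fun n t t' => cd T (Negz n.+1) \oc t' = t \oc cd X (Negz n.+1)) b.
- by rewrite db -cmpA (cdd X (Negz 1)) cmpm0.
- move=> n t dt; have [|t' t'E] := Tac (XP (Negz n.+1)) (g := t \oc cd X (Negz n.+1)).
    by rewrite cmpA.
  by exists t'; rewrite t'E -cmpA (cdd X (Negz n.+2)) cmpm0.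
pose f i : hom (X i) (T i) :=
  match i with Posz 0 => a | Posz n.+1 => 0 | Negz n => v n end.
suff fE i : cd T i \oc f i = f (isucc i) \oc cd X i by exists (Cmap fE).
case: i => [[|n]|[|n]] /=.
- by rewrite cmp0m.
- by rewrite cmpm0 cmp0m.
- by rewrite v0.
- exact: vE.
Qed.

Lemma null_homotopic_of_deg0 (f : cmap X T) (s : hom (X (Posz 0)) (T (Negz 0))) :
  f (Posz 0) = cd T (Negz 0) \oc s -> null_homotopic f.
Proof.
move=> sE.
(* The n-th component goes from degree -n to degree -n-1. The invariant makes f - t d a cocycle in
   degree -n-1, and its primitive is the next component. *)
have [||h [h0 hE]] := @nat_dependent_choice
  (fun n => hom (X (isucc (Negz n))) (T (Negz n)))
  (fun n t => (f (isucc (Negz n)) - cd T (Negz n) \oc t) \oc cd X (Negz n) = 0)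
  (fun n t t' => f (Negz n) = cd T (Negz n.+1) \oc t' + t \oc cd X (Negz n)) s.
- by rewrite /= sE subrr cmp0m.
- move=> n t tE.
  have [|t' t'E] := Tac (XP (Negz n)) (g := f (Negz n) - t \oc cd X (Negz n)).
    by rewrite cmpBr cmE cmpA -cmpBl.
  exists t'; rewrite /= t'E subrK opprB addrCA subrr addr0; split=> //.
  by rewrite -cmpA (cdd X (Negz n.+1)) cmpm0.
pose k (i : int) : hom (X (isucc i)) (T i) :=
  match i return hom (X (isucc i)) (T i) with Posz n => 0 | Negz n => h n end.
exists k; case=> [n|[|n]] /=.
- exact: (zero_source _ _ (X0 n)).
- by rewrite cmp0m addr0 h0.
- exact: hE.
Qed.

End ComparisonMap.

(** The presentation is X^{-1} -> X^0 -> X. Existence of the factorization comes from [extend_cmap],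
    uniqueness from [null_homotopic_of_deg0]. *)
Lemma le0_presented P X :
  (forall i, P (X i)) -> le0 X -> presented P X.
Proof.
move=> XP X0; have dq := le0_cd0 (idm (X (Posz 0))) X0.
have dd := le0_cd0 (X := sgl (X (Posz 0))) (cd X (Negz 0)) (@sgl_le0 A _).
exists (X (Negz 0)), (X (Posz 0)), (kh (sgl_map dd)), (kh (sgl_map dq)).
split=> //.
- by rewrite sgl_mapM; apply/sgl_map_eq0; exists (idm _); rewrite /= cmp1m cmpm1.
- move=> E z; have [a [da ->]] := sgl_homP z.
  exists (kh (sgl_map (le0_cd0 (X := sgl (X (Posz 0))) a (@sgl_le0 A _)))).
  rewrite sgl_mapM; apply/sgl_map_eq; exists 0.
  by rewrite /= cmp1m subrr cmpm0.
- move=> T Tac t; have [a [da ->]] := sgl_homP t.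
  rewrite sgl_mapM => /sgl_map_eq0[b bE].
  have [f fE] := extend_cmap XP Tac da (esym bE).
  exists (kh f); split.
    rewrite sgl_mapM; apply/sgl_map_eq; exists 0.
    by rewrite /= cmpm1 fE subrr cmpm0.
  move=> v; have [g ->] := khP v.
  rewrite sgl_mapM => /sgl_map_eq[s /= sE]; apply/khE.
  apply: (null_homotopic_of_deg0 XP X0 Tac (s := - s)).
  by rewrite /= cmpmN -sE cmpm1 opprB fE.
Qed.

Lemma presented_isom P X Y : @isom K X Y -> presented P X -> presented P Y.
Proof.
case=> f [g [gf fg]] [E1 [E0 [d [q [P1 P0 qd qs qu]]]]].
exists E1, E0, d, (f \oc q); split=> //.
- by rewrite -cmpA qd cmpm0.
- move=> E z; have [m mE] := qs E (g \oc z); exists m.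
  by rewrite -cmpA mE cmpA fg cmp1m.
- move=> T Tac t td; have [v [vq vu]] := qu T Tac t td.
  exists (v \oc g); split; first by rewrite -cmpA (cmpA g) gf cmp1m.
  by move=> w wE; rewrite (vu (w \oc f)) -?cmpA ?fg ?cmpm1.
Qed.

Lemma leA_presented P X : additive_sub P -> karoubi_closed P ->
  (forall i, P (X i)) -> leA (X : K) -> presented P X.
Proof.
move=> Pa Pk XP Xle; have [Y [XY Y0 YP]] := leA_strict Pa Pk XP Xle.
exact: presented_isom (isom_sym XY) (le0_presented YP Y0).
Qed.

(** Right exactness of X -> Y -> Z -> 0 after applying the functors
    [hom (sgl E)], E in P. *)
Definition pointwise_cokernel P X Y Z (f : @hom K X Y) (g : @hom K Y Z) : Prop :=
  [/\ g \oc f = 0,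
      forall E (z : @hom K (sgl E) Z), P E -> exists y, g \oc y = z &
      forall E (y : @hom K (sgl E) Y), P E -> g \oc y = 0 ->
        exists x, f \oc x = y].

Lemma pointwise_cokernelP P X Y Z T (f : @hom K X Y) (g : @hom K Y Z)
    (w : @hom K Y T) :
    pointwise_cokernel P f g -> presented P Y -> presented P Z ->
    neg_acyclic P T -> w \oc f = 0 ->
  exists! v : @hom K Z T, v \oc g = w.
Proof.
move=> [gf gs ex] [F1 [F0 [dY [qY [_ PF0 qdY _ quY]]]]].
move=> [E1 [E0 [d [q [PE1 PE0 qd qs qu]]]]] Tac wf.
(* The generator q of Z lifts to s in Y, and s d comes from X because q d = 0; thus w s kills d and
   descends to v. *)
have [s gq] := gs E0 q PE0.
have [p fp] : exists p, f \oc p = s \oc d by apply: ex; rewrite // cmpA gq.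
have [|v [vq vu]] := qu T Tac (w \oc s).
  by rewrite -cmpA -fp cmpA wf cmp0m.
exists v; split; last first.
  by move=> v' v'g; apply: vu; rewrite -gq cmpA v'g.
(* The equation v g = w need only be checked on the generator qY of Y, which differs from s m by an
   element coming from X. *)
have [m mE] := qs F0 (g \oc qY).
have [|n nE] := ex F0 (qY - s \oc m) PF0.
  by rewrite cmpBr cmpA gq mE subrr.
have wqd : (w \oc qY) \oc dY = 0 by rewrite -cmpA qdY cmpm0.
have [u [_ uu]] := quY T Tac _ wqd.
rewrite -(uu w erefl); apply/esym/uu.
rewrite -cmpA -mE cmpA vq -cmpA; apply/eqP; rewrite eq_sym -subr_eq0 -cmpBr -nE.
by rewrite cmpA wf cmp0m.
Qed.

(** A pointwise bijection is a pointwise cokernel of 0 : X -> X, so the identity of X factors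
    through f; uniqueness of factorizations makes this left inverse two-sided. *)
Lemma pointwise_iso P X Y (f : @hom K X Y) :
    (forall E (y : @hom K (sgl E) Y), P E -> exists x, f \oc x = y) ->
    (forall E (x : @hom K (sgl E) X), P E -> f \oc x = 0 -> x = 0) ->
    presented P X -> presented P Y -> neg_acyclic P X -> neg_acyclic P Y ->
  is_iso f.
Proof.
move=> fs fi Xp Yp Xac Yac.
have pc : pointwise_cokernel P (0 : @hom K X X) f.
  split; [exact: cmpm0| exact: fs| ].
  by move=> E x PE fx; exists 0; rewrite cmpm0 (fi E x PE fx).
have [v [vf _]] := pointwise_cokernelP pc Xp Yp Xac (cmpm0 _ (idm (X : K))).
exists v; split=> //.
have [u [_ uu]] := pointwise_cokernelP pc Xp Yp Yac (cmpm0 _ f).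
by rewrite -(uu (idm (Y : K)) (cmp1m _)); apply/esym/uu; rewrite -cmpA vf cmpm1.
Qed.

End NegativeAcyclicity.

(** * The truncation functor, its unit, and cokernels in the heart of K^-(A) *)

Section Hearts.
Variable A : abcat.
Notation K := (Kminus A).
Implicit Types (X Y Z T V W : cpx A) (E M : A) (P : A -> Prop).

Definition all_ob (E : A) : Prop := True.

Lemma leA_presented_all X : leA (X : K) -> presented all_ob X.
Proof. by apply: leA_presented. Qed.

Lemma presented_hom0 P X T (f : @hom K X T) :
    presented P X -> neg_acyclic P T ->
    (forall E (x : @hom K (sgl E) X), P E -> f \oc x = 0) ->
  f = 0.
Proof.
move=> [E1 [E0 [d [q [_ PE0 _ _ qu]]]]] Tac f0.
have [v [_ vu]] := qu T Tac 0 (cmp0m _ d).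
by rewrite -(vu f (f0 _ q PE0)); apply: vu; rewrite cmp0m.
Qed.

Lemma hom_shift_eq0 P X Y (f : @hom K (shift Y) X) :
    additive_sub P -> karoubi_closed P -> (forall i, P (Y i)) ->
    leA (Y : K) -> neg_acyclic P X ->
  f = 0.
Proof.
move=> Pa Pk YP Yle Xac.
have [h hY] := sig_incl_null (hom_sig_leA (kh (sig_incl Y)) Yle).
(* The contraction of Y moved down one degree; the sign matches the differential of the shift. The
   component [h 0] left over is used below to bound degree-1 cocycles of Y. *)
have hS : @pos_contraction A (shift Y) (fun n => - h n.+1).
  by move=> n /=; rewrite cmpNm !cmpmN cmpNm !opprK; apply: hY.
have Sle : leA (shift Y : K).
  apply/leAP; exists (trle (shift Y)).
  by split; [apply: trle_isom hS | apply: trle_le0].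
have SP i : P (shift Y i) := YP (isucc i).
apply: (presented_hom0 (leA_presented Pa Pk SP Sle) Xac) => E x _.
have [a [da ->]] := sgl_homP x.
suff -> : kh (sgl_map da) = 0 by rewrite cmpm0.
apply/sgl_map_eq0; exists (- (h 0 \oc a)).
have da' : cd Y (Posz 1) \oc a = 0.
  by apply: oppr_inj; rewrite oppr0 -cmpNm; apply: da.
rewrite /= cmpNm cmpmN opprK cmpA -[LHS]cmp1m [X in X \oc a](hY 0).
by rewrite cmpDl -[X in _ + X]cmpA da' cmpm0 addr0.
Qed.

Lemma tau_kh X Y (f : cmap X Y) : fmap (tau A) (kh f) = kh (tau_cmap f).
Proof. exact/tau_cls/hrepK. Qed.

Lemma tau_additive : additive_functor (tau A).
Proof.
move=> X Y f g; have [f0 ->] := khP f; have [g0 ->] := khP g.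
have -> : kh f0 + kh g0 = kh (f0 + g0) by rewrite /kh hclsD.
rewrite !tau_kh -[RHS]hclsD; apply: kh_eq => -[n|[|[|n]]] //=.
  by apply: kerm_monic; rewrite cmpDr !kerliftE cmpDl.
by rewrite addr0.
Qed.

(** Components of the canonical map from X to its truncation; in degree -2 it is d^{-2} corestricted
    to ker d^{-1}. *)
Definition eta_cm X (i : int) : hom (X i) (tau_cpx X i) :=
  match i with
  | Posz n => idm (X (Posz n))
  | Negz 0 => idm (X (Negz 0))
  | Negz 1 => kerlift (cdd X (Negz 1))
  | Negz _.+2 => 0
  end.

Definition eta_cmap X : cmap X (tau_cpx X).
Proof.
exists (eta_cm X); case=> [n|[|[|[|n]]]] /=.
- by rewrite cmp1m cmpm1.
- by rewrite cmp1m cmpm1.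
- by rewrite cmp1m kerliftE.
- apply: kerm_monic; rewrite !cmpm0 cmpA kerliftE; exact/esym/(cdd X (Negz 2)).
- by rewrite cmpm0 cmp0m.
Defined.

Definition eta (X : K) : hom X (tau A X) := kh (eta_cmap X).

Lemma eta_natural X Y (f : @hom K X Y) : fmap (tau A) f \oc eta X = eta Y \oc f.
Proof.
have [g ->] := khP f; rewrite tau_kh !khM; apply: kh_eq.
case=> [n|[|[|n]]] /=; rewrite ?cmpm1 ?cmp1m ?cmp0m //.
by apply: kerm_monic; rewrite !cmpA !kerliftE -cmpA kerliftE; apply/esym/cmE.
Qed.

Lemma tau_eta (X : K) : fmap (tau A) (eta X) = eta (tau A X).
Proof.
rewrite tau_kh; apply: kh_eq => -[n|[|[|n]]] //=.
by apply: kerm_monic; rewrite !kerliftE /= cmp1m.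
Qed.

Lemma tau_leA (X : K) : leA X -> leA (tau A X).
Proof.
move=> /leAP[Y [XY Y0]]; apply: (@leA_isom A (tau_cpx Y)).
  exact/isom_sym/(fmap_isom (tau A) XY).
by apply/leAP; exists (tau_cpx Y); split; first exact: isom_refl.
Qed.

Lemma tau_geA (X : K) : geA (tau A X).
Proof. by apply: geA_kernel => [n|]; [apply: zobP | apply: kerP]. Qed.

(** Morphisms out of [sgl E] see only degrees -1, 0 and 1, where [eta] is the identity. *)
Lemma eta_surj X E (y : @hom K (sgl E) (tau_cpx X)) : exists x, eta X \oc x = y.
Proof.
have [a [da ->]] := sgl_homP y; exists (kh (@sgl_map A E X a da)).
by rewrite sgl_mapM; apply/sgl_map_eq; exists 0; rewrite /= cmp1m subrr cmpm0.
Qed.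

Lemma eta_inj X E (x : @hom K (sgl E) X) : eta X \oc x = 0 -> x = 0.
Proof.
have [a [da ->]] := sgl_homP x; rewrite sgl_mapM => /sgl_map_eq0[s sE].
by apply/sgl_map_eq0; exists s; rewrite -[LHS]cmp1m.
Qed.

Lemma eta_iso (X : K) : inHA X -> is_iso (eta X).
Proof.
move=> [Xle Xge]; apply: (@pointwise_iso A all_ob).
- by move=> E y _; apply: eta_surj.
- by move=> E x _; apply: eta_inj.
- exact: leA_presented_all.
- exact/leA_presented_all/tau_leA.
- exact: geA_neg_acyclic.
- exact/geA_neg_acyclic/tau_geA.
Qed.

(** * Cokernels from truncated mapping cones *)

Section Cone.
Variables (X Y : cpx A) (f : cmap X Y).
Hypotheses (X0 : le0 X) (Y0 : le0 Y).

Definition cone_d : hom (bip (X (Posz 0)) (Y (Negz 0))) (Y (Posz 0)) :=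
  f (Posz 0) \oc prl _ _ + cd Y (Negz 0) \oc prr _ _.

Lemma cone_d_injl : cone_d \oc injl _ _ = f (Posz 0).
Proof. by rewrite cmpDl -!cmpA prl_injl prr_injl cmpm0 addr0 cmpm1. Qed.

Lemma cone_d_injr : cone_d \oc injr _ _ = cd Y (Negz 0).
Proof. by rewrite cmpDl -!cmpA prl_injr prr_injr cmpm0 add0r cmpm1. Qed.

Definition cone : cpx A := cpx3 (kerP cone_d).1.

Lemma cone_inHA : inHA (cone : K).
Proof.
split.
  by apply/leAP; exists cone; split; [apply: isom_refl | move=> n; apply: zobP].
by apply: geA_kernel => [n|]; [apply: zobP | apply: kerP].
Qed.

Lemma cone_proof : cone_d \oc (injr (X (Posz 0)) _ \oc cd Y (Negz 1)) = 0.
Proof. by rewrite cmpA cone_d_injr (cdd Y (Negz 1)). Qed.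

Definition cone_proj_cm (i : int) : hom (Y i) (cone i) :=
  match i with
  | Posz 0 => idm (Y (Posz 0)) | Posz n.+1 => 0
  | Negz 0 => injr _ _ | Negz 1 => kerlift cone_proof | Negz n.+2 => 0
  end.

Definition cone_proj : cmap Y cone.
Proof.
exists cone_proj_cm; case=> [[|n]|[|[|[|n]]]] /=; rewrite ?cmp0m ?cmpm0 //.
- by rewrite cone_d_injr cmp1m.
- exact: kerliftE.
- apply: kerm_monic; rewrite cmpm0 cmpA kerliftE -cmpA (cdd Y (Negz 2)).
  by rewrite cmpm0.
Defined.

Lemma cone_pointwise P : pointwise_cokernel P (kh f) (kh cone_proj).
Proof.
split.
(* The composite is zero once it is zero on every [sgl E]; there the left injection into the
   biproduct gives the null homotopy. *)
- have leX : leA (X : K) by apply/leAP; exists X; split; first exact: isom_refl.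
  apply: (presented_hom0 (leA_presented_all leX)).
    exact/geA_neg_acyclic/cone_inHA.2.
  move=> E x _; have [a [da ->]] := sgl_homP x.
  rewrite khM sgl_mapM; apply/sgl_map_eq0; exists (injl _ _ \oc a).
  by rewrite /= cmp1m cmpA cone_d_injl.
- move=> E z _; have [a [da ->]] := sgl_homP z.
  exists (kh (sgl_map (le0_cd0 (a : hom E (Y (Posz 0))) Y0))).
  by rewrite sgl_mapM; apply/sgl_map_eq; exists 0; rewrite /= cmp1m subrr cmpm0.
- move=> E y _; have [a [da ->]] := sgl_homP y.
  rewrite sgl_mapM => /sgl_map_eq0[s sE].
  have {}sE : a = cone_d \oc s by rewrite -sE [RHS]cmp1m.
  (* The two components of s write a as f x + d y: the first is the preimage x, the second yields
     the homotopy. *)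
  exists (kh (sgl_map (le0_cd0 (prl _ _ \oc s) X0))).
  rewrite sgl_mapM; apply/sgl_map_eq; exists (- (prr _ _ \oc s)).
  by rewrite /= sE cmpDl -!cmpA opprD addrA subrr sub0r cmpmN.
Qed.

End Cone.

Lemma exists_pointwise_cokernel (X Y : K) (f : hom X Y) : leA X -> leA Y ->
  exists (W : K) (c : hom Y W), inHA W /\ forall P, pointwise_cokernel P f c.
Proof.
move=> /leAP[X' [[u [u' [u'u uu']]] X0]] /leAP[Y' [[v [v' [v'v vv']]] Y0]].
have [g gE] := khP (v \oc f \oc u').
exists (cone g), (kh (cone_proj g) \oc v); split; first exact: cone_inHA.
move=> P; have [cf cs ce] := cone_pointwise g X0 Y0 P; split.
- rewrite -(cmpm1 (_ \oc f)) -u'u cmpA -(cmpA _ v f) -(cmpA _ (v \oc f)) gE.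
  by rewrite cf cmp0m.
- move=> E z PE; have [y yE] := cs E z PE.
  by exists (v' \oc y); rewrite cmpA -(cmpA (kh _)) vv' cmpm1.
- move=> E y PE; rewrite -cmpA => /(ce E _ PE)[x xE].
  exists (u' \oc x); rewrite -[RHS]cmp1m -v'v -[RHS]cmpA -xE -gE -!cmpA.
  by rewrite [RHS]cmpA v'v cmp1m.
Qed.

(** Comparison with the truncated cone W makes Z a retract of W under Y. The retraction gives
    surjectivity onto Z, and the section reduces exactness at Y to that for W. *)
Lemma cokernel_pointwise P (X Y Z : K) (f : hom X Y) (g : hom Y Z) :
    inHA X -> inHA Y -> inHA Z -> cokernel_in (@inHA A) f g ->
  pointwise_cokernel P f g.
Proof.
move=> XHA YHA ZHA [gf gu].
have [W [c [WHA cP]]] := exists_pointwise_cokernel f XHA.1 YHA.1.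
have [cf cs ce] := cP P.
have [u [ug _]] := gu W WHA c cf.
have [v [vc _]] := pointwise_cokernelP (cP all_ob)
  (leA_presented_all YHA.1) (leA_presented_all WHA.1)
  (geA_neg_acyclic (P := all_ob) ZHA.2) gf.
have vu : v \oc u = idm Z.
  have [w [_ wu]] := gu Z ZHA g gf.
  by rewrite -(wu _ (cmp1m g)); apply/esym/wu; rewrite -cmpA ug vc.
split=> //.
- move=> E z PE; have [y yE] := cs E (u \oc z) PE; exists y.
  by rewrite -vc -cmpA yE cmpA vu cmp1m.
- by move=> E y PE gy; apply: ce => //; rewrite -ug -cmpA gy cmpm0.
Qed.

Lemma cokernel_HA_pointwise P (X Y Z : HA A) (f : hom X Y) (g : hom Y Z) :
  is_cokernel f g -> @pointwise_cokernel A P (sval X) (sval Y) (sval Z) f g.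
Proof.
by move/fullsub_cokernel; apply: cokernel_pointwise; apply: svalP.
Qed.

End Hearts.

(** * Approximations *)

Section Approximations.
Variables (A : abcat) (C : A -> Prop).
Hypotheses (Cadd : additive_sub C) (Ckar : karoubi_closed C).
Notation K := (Kminus A).
Implicit Types (E M : A).

Lemma sgl_inTC E : C E -> @inTC A C (sgl E).
Proof. by have [C0 _] := Cadd; move=> CE [[|n]|[|[|n]]]. Qed.

Lemma sig_inTC (X : cpx A) : @inTC A C X -> @inTC A C (sig X).
Proof. by have [C0 _] := Cadd; move=> CX [[|n]|n] //; apply: (CX (Posz n.+1)). Qed.

Lemma inHC_presented (X : TC C) : leC X -> presented C (sval X).
Proof. exact: leA_presented Cadd Ckar (svalP X). Qed.

Lemma inHC_neg_acyclic (X : TC C) : geC X -> neg_acyclic C (sval X).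
Proof. exact: geC_neg_acyclic Cadd.1. Qed.

Section Approximation.
Variables (X : K) (XC : TC C) (e : @hom K (sval XC) X).
Hypothesis eP : @is_approximation A C X XC e.

Lemma approx_lift (Q : K) (f : hom Q X) : @inTC A C Q ->
  exists g : @hom K Q (sval XC), e \oc g = f.
Proof.
move=> QC; have [u _ uK] := eP.2 (exist _ Q QC).
by exists (u f); apply: (uK f).
Qed.

Lemma approx_inj (Q : K) (f g : @hom K Q (sval XC)) : @inTC A C Q ->
  e \oc f = e \oc g -> f = g.
Proof. by move=> QC; apply: (bij_inj (eP.2 (exist _ Q QC))). Qed.

(** Composition with e is injective on maps from complexes over C, so [sig XC] -> XC is zero because
    every map from [sig XC] to X is. *)
Lemma approx_leC : leA X -> leC XC.
Proof.
move=> Xle; apply/sig_incl_null_leA/approx_inj.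
  exact/sig_inTC/(svalP XC).
by rewrite cmpm0; apply: hom_sig_leA.
Qed.

Lemma approx_geC : geA X -> geC XC.
Proof.
move=> Xge Y Yle f; have SC : @inTC A C (shift (sval Y)).
  by move=> i; apply: (svalP Y).
apply: approx_inj SC _; rewrite cmpm0.
apply: (@hom_shift_eq0 A (@all_ob A)) => //.
exact: geA_neg_acyclic.
Qed.

End Approximation.

(** H^0 of [sgl M] is M, so an isomorphism on H^0 forces f^0 restricted to cocycles to be epic. *)
Lemma quasi_iso_deg0_epic (X : cpx A) M (f : cmap X (sgl M)) W (w : hom M W) :
    quasi_iso (kh f) -> w \oc (f (Posz 0) \oc kerm (cd X (Posz 0))) = 0 ->
  w = 0.
Proof.
case=> g [/khE[h hE] /(_ (Posz 0))[j [_ cj]]] wf.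
(* The representative g that is invertible on cohomology agrees with f on cocycles, as the
   differential of [sgl M] into degree 0 vanishes. *)
have wg : w \oc (g (Posz 0) \oc kerm (cd X (Posz 0))) = 0.
  have /eqP := hE (Negz 0); rewrite /= cmp0m add0r subr_eq => /eqP ->.
  by rewrite cmpDl -(cmpA _ _ (kerm _)) (kerP _).1 cmpm0 add0r wf.
have wb : (w \oc kerm (cd (sgl M) (Posz 0))) \oc bnd (sgl M) (Posz 0) = 0.
  exact: (zero_source _ _ (zobP A)).
have w0 : cokerdesc wb = 0.
  rewrite -(cmpm1 (cokerdesc wb)) -cj cmpA.
  suff -> : cokerdesc wb \oc coh_map g (Posz 0) = 0 by rewrite cmp0m.
  apply: (is_cokernel_epic (cokerP (bnd X (Posz 0)))).
  rewrite cmp0m -cmpA cokerdescE cmpA cokerdescE -cmpA kerliftE.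
  exact: wg.
have k1 : cd (sgl M) (Posz 0) \oc idm M = 0 by rewrite cmp0m.
by rewrite -(cmpm1 w) -(kerliftE k1) cmpA -(cokerdescE wb) w0 !cmp0m.
Qed.

(** The cover is the degree-0 component of an approximation of [sgl M], made strict: the
    quasi-isomorphism gives epicness, the bijection on morphisms gives the lifting property. *)
Lemma approximating_cover M : approximating C ->
  exists (D : A) (c : hom D M), C_cover C c.
Proof.
move=> Capp; have [XC [e eP]] := Capp (sgl M : K).
have Mle : leA (sgl M : K).
  by apply/leAP; exists (sgl M); split; [apply: isom_refl | apply: sgl_le0].
have [Y [[u [u' [u'u uu']]] Y0 YC]] :=
  leA_strict Cadd Ckar (svalP XC) (approx_leC eP Mle).
have [f fE] := khP (e \oc u').
exists (Y (Posz 0)), (f (Posz 0)); split; first exact: YC.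
split=> [W g h gh|E EC g].
  have [u0 u0E] := khP u.
  apply/eqP; rewrite -subr_eq0; apply/eqP.
  apply: (@quasi_iso_deg0_epic _ _ (cmapM f u0)).
    by rewrite -khM -u0E -fE -cmpA u'u cmpm1; apply: eP.1.
  by rewrite /= !cmpA [X in X \oc _ \oc _]cmpBl gh subrr !cmp0m.
have dg := le0_cd0 (X := sgl M) g (@sgl_le0 A M).
have [x xE] := approx_lift eP (kh (sgl_map dg)) (sgl_inTC EC).
have [a [da aE]] := sgl_homP (u \oc x).
have := xE; rewrite -(cmp1m x) -u'u -!cmpA aE cmpA fE sgl_mapM.
move=> /sgl_map_eq[s /=]; rewrite cmp0m => /eqP; rewrite subr_eq0 => /eqP sE.
by exists a.
Qed.

End Approximations.

(** * The adjoint pair between the hearts *)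

Section AdjointPair.
Variables (A : abcat) (C : A -> Prop).
Hypotheses (Cadd : additive_sub C) (Ckar : karoubi_closed C).
Variable ch : forall X : Kminus A, approximation C X.
Notation K := (Kminus A).

Let pi_ob (X : K) : K := sval (apx_ob (ch X)).
Let e (X : K) : @hom K (pi_ob X) X := apx (ch X).

Definition pi_mor (X Y : K) (f : hom X Y) : @hom K (pi_ob X) (pi_ob Y) :=
  fmap (piC ch) f.

Lemma pi_morE (X Y : K) (f : hom X Y) : e Y \oc pi_mor f = f \oc e X.
Proof. exact: pi_mapE. Qed.

Lemma pi_inj (Q X : K) (f g : @hom K Q (pi_ob X)) : @inTC A C Q ->
  e X \oc f = e X \oc g -> f = g.
Proof. exact: (approx_inj (apxP (ch X))). Qed.

Lemma pi_lift (Q X : K) (f : hom Q X) : @inTC A C Q ->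
  exists g : @hom K Q (pi_ob X), e X \oc g = f.
Proof. exact: (approx_lift (apxP (ch X))). Qed.

Lemma piC_additive : additive_functor (piC ch).
Proof.
move=> X Y f g; suff : pi_mor (f + g) = pi_mor f + pi_mor g by [].
apply: pi_inj; first exact: (svalP (apx_ob (ch X))).
by rewrite cmpDr !pi_morE cmpDl.
Qed.

Lemma piC_inHC (X : K) : inHA X -> inHC (piC ch X).
Proof.
case=> Xle Xge; split; first exact: approx_leC (apxP (ch X)) Xle.
exact: approx_geC (apxP (ch X)) Xge.
Qed.

Lemma tauTC_inHA (X : TC C) : inHC X -> inHA (tauTC C X).
Proof. by case=> Xle _; split; [apply: tau_leA | apply: tau_geA]. Qed.

Lemma tau_pi_unit_exists (X : TC C) :
  { u : @hom K (sval X) (pi_ob (tau A (sval X))) | e _ \oc u = eta (sval X) }.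
Proof. exact/cid/pi_lift/(svalP X). Qed.

Definition tau_pi_unit (X : TC C) : @hom K (sval X) (pi_ob (tau A (sval X))) :=
  sval (tau_pi_unit_exists X).

Lemma tau_pi_unitE (X : TC C) : e _ \oc tau_pi_unit X = eta (sval X).
Proof. exact: (svalP (tau_pi_unit_exists X)). Qed.

Lemma tau_pi_unit_natural (X Y : TC C) (f : @hom K (sval X) (sval Y)) :
  pi_mor (fmap (tau A) f) \oc tau_pi_unit X =
  tau_pi_unit Y \oc f.
Proof.
apply: pi_inj; first exact: svalP.
by rewrite !cmpA pi_morE tau_pi_unitE -cmpA tau_pi_unitE eta_natural.
Qed.

Definition eta_inv (V : HA A) : @hom K (tau A (sval V)) (sval V) :=
  sval (cid (eta_iso (svalP V))).

Lemma eta_invK (V : HA A) : eta_inv V \oc eta (sval V) = idm (sval V).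
Proof. by rewrite /eta_inv; case: cid => g []. Qed.

Lemma eta_invVK (V : HA A) : eta (sval V) \oc eta_inv V = idm (tau A (sval V)).
Proof. by rewrite /eta_inv; case: cid => g []. Qed.

Lemma eta_inv_natural (V W : HA A) (f : @hom K (sval V) (sval W)) :
  f \oc eta_inv V = eta_inv W \oc fmap (tau A) f.
Proof.
rewrite -[LHS]cmp1m -(eta_invK W) -cmpA (cmpA (eta _)) -eta_natural -cmpA.
by rewrite eta_invVK cmpm1.
Qed.

Definition tau_pi_counit (V : HA A) :
    @hom K (tau A (pi_ob (sval V))) (sval V) :=
  eta_inv V \oc fmap (tau A) (e (sval V)).

Lemma tau_pi_counit_natural (V W : HA A) (f : @hom K (sval V) (sval W)) :
  f \oc tau_pi_counit V =
  tau_pi_counit W \oc fmap (tau A) (pi_mor f).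
Proof. by rewrite cmpA eta_inv_natural -!cmpA -!fmapM pi_morE. Qed.

Lemma tau_pi_triangleL (X : TC C) (h : inHA (tau A (sval X))) :
  tau_pi_counit (exist _ (tau A (sval X)) h) \oc fmap (tau A) (tau_pi_unit X) =
  idm (tau A (sval X)).
Proof.
rewrite -cmpA -fmapM tau_pi_unitE tau_eta.
exact: (eta_invK (exist _ (tau A (sval X)) h)).
Qed.

Lemma tau_pi_triangleR (V : HA A) :
  pi_mor (tau_pi_counit V) \oc
    tau_pi_unit (piC ch (sval V)) = idm (pi_ob (sval V)).
Proof.
apply: pi_inj; first exact: (svalP (apx_ob (ch (sval V)))).
rewrite cmpA pi_morE -cmpA tau_pi_unitE -cmpA eta_natural cmpA eta_invK.
by rewrite cmp1m cmpm1.
Qed.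

Variables (htau : forall X : TC C, inHC X -> inHA (tauTC C X))
  (hpi : forall X : K, inHA X -> inHC (piC ch X)).

Definition tau_pi_adjunction : adjunction (tauH htau) (piH hpi).
Proof.
refine (@Adj (HC C) (HA A) (tauH htau) (piH hpi)
  (fun X => tau_pi_unit (sval X)) tau_pi_counit _ _ _ _).
- by move=> X Y f; apply: tau_pi_unit_natural.
- by move=> V W f; apply: tau_pi_counit_natural.
- by move=> X; apply: tau_pi_triangleL.
- by move=> V; apply: tau_pi_triangleR.
Defined.

(** For E in C, composition with either [e] or [eta] is bijective on morphisms from [sgl E], hence
    so is composition with the unit. *)
Lemma tau_pi_unit_iso (X : HC C) : is_iso (adj_unit tau_pi_adjunction X).
Proof.
set u := tau_pi_unit (sval X).
have pX : inHC (piC ch (tau A (sval (sval X)))).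
  exact/piC_inHC/(tauTC_inHA (svalP X)).
suff : is_iso u by [].
apply: (@pointwise_iso A C).
- move=> E y CE; have [x xE] := eta_surj (e _ \oc y).
  exists x; apply: pi_inj; first exact: sgl_inTC.
  by rewrite cmpA tau_pi_unitE.
- move=> E x CE ux; apply: eta_inj.
  by rewrite -tau_pi_unitE -cmpA ux cmpm0.
- exact: inHC_presented (svalP X).1.
- exact: inHC_presented pX.1.
- exact: inHC_neg_acyclic (svalP X).2.
- exact: inHC_neg_acyclic pX.2.
Qed.

Lemma pi_pointwise_cokernel (X Y Z : K) (f : hom X Y) (g : hom Y Z) :
  pointwise_cokernel C f g -> pointwise_cokernel C (pi_mor f) (pi_mor g).
Proof.
case=> gf gs ex; split.
- apply: pi_inj; first exact: (svalP (apx_ob (ch X))).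
  by rewrite cmpA pi_morE -cmpA pi_morE cmpA gf cmp0m cmpm0.
- move=> E z CE; have [y yE] := gs E (e _ \oc z) CE.
  have [y' y'E] := pi_lift y (sgl_inTC Cadd CE); exists y'.
  apply: pi_inj; first exact: sgl_inTC.
  by rewrite cmpA pi_morE -cmpA y'E yE.
- move=> E y CE gy; have [|x xE] := ex E (e _ \oc y) CE.
    by rewrite cmpA -pi_morE -cmpA gy cmpm0.
  have [x' x'E] := pi_lift x (sgl_inTC Cadd CE); exists x'.
  apply: pi_inj; first exact: sgl_inTC.
  by rewrite cmpA pi_morE -cmpA x'E xE.
Qed.

Lemma HC_cokernel (X Y Z : HC C)
    (f : @hom K (sval (sval X)) (sval (sval Y)))
    (g : @hom K (sval (sval Y)) (sval (sval Z))) :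
  pointwise_cokernel C f g -> @is_cokernel (HC C) X Y Z f g.
Proof.
move=> pc; apply: fullsub_fullsub_cokernel.
split=> [|W [WC WHC] w wf]; first by have [gf _ _] := pc.
apply: (pointwise_cokernelP pc) wf.
- exact: inHC_presented (svalP Y).1.
- exact: inHC_presented (svalP Z).1.
- exact: inHC_neg_acyclic WHC.2.
Qed.

Lemma piH_cokernel (X Y Z : HA A) (f : hom X Y) (g : hom Y Z) :
  is_cokernel f g -> is_cokernel (fmap (piH hpi) f) (fmap (piH hpi) g).
Proof.
move=> gcok.
have pc := @pi_pointwise_cokernel _ _ _ f g (@cokernel_HA_pointwise A C X Y Z f g gcok).
exact: (@HC_cokernel (piH hpi X) (piH hpi Y) (piH hpi Z) (pi_mor f) (pi_mor g) pc).
Qed.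

Lemma pi_zero (V : K) : inHA V ->
  is_zero (pi_ob V) <-> forall E (x : @hom K (sgl E) V), C E -> x = 0.
Proof.
move=> VHA; split=> [V0 E x CE|V0].
  have [y <-] := pi_lift x (sgl_inTC Cadd CE).
  by rewrite (zero_target y 0 V0) cmpm0.
have [Vle Vge] := piC_inHC VHA.
apply: (presented_hom0 (inHC_presented Cadd Ckar Vle) (inHC_neg_acyclic Cadd Vge)).
move=> E x CE; rewrite cmp1m; apply: pi_inj; first exact: sgl_inTC.
by rewrite cmpm0; apply: V0.
Qed.

End AdjointPair.

(** * Complexes with a cover component and vanishing on C *)

Section ClassC.
Variables (A : abcat) (C : A -> Prop).
Notation K := (Kminus A).

(** A map from E in C to the degree-0 term Z lifts through the cover D -> Z, a component of the last
    differential, and is therefore a coboundary. *)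
Lemma classC_hom0 (V : HA A) E (x : @hom K (sgl E) (sval V)) :
  classC C V -> C E -> x = 0.
Proof.
case=> X [D [Y [Z [f [g [gf [h [[_ [_ cov]] iV]]]]]]]] CE.
have [u [v [vu _]]] := fullsub_isom iV.
rewrite -(cmp1m x) -vu -cmpA.
have [a [da ->]] := sgl_homP (u \oc x).
suff -> : kh (sgl_map da) = 0 by rewrite cmpm0.
have [b bE] := cov E CE a; apply/sgl_map_eq0; exists (injl D Y \oc b).
by rewrite /= cmpA bE.
Qed.

Lemma hom0_classC (V : HA A) :
    (forall M, exists (D : A) (c : hom D M), C_cover C c) ->
    (forall E (x : @hom K (sgl E) (sval V)), C E -> x = 0) ->
  classC C V.
Proof.
move=> cov V0; have /leAP[V' [VV' V'0]] := (svalP V).1.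
have [D [c cC]] := cov (V' (Posz 0)).
pose f := sgl_map (le0_cd0 c V'0).
have f0 : kh f = 0.
  have [u [v [_ uv]]] := VV'.
  by rewrite -(cmp1m (kh f)) -uv -cmpA (V0 D (v \oc kh f) cC.1) cmpm0.
have [_ ps pe] := cone_pointwise f (@sgl_le0 A D) V'0 (@all_ob A).
have V'HA : inHA (V' : K).
  case: (svalP V) => Vle [U [VU UP]]; split; first exact: leA_isom VV' Vle.
  by exists U; split=> //; apply: isom_trans (isom_sym VV') VU.
have [Wle Wge] := cone_inHA f.
(* Since f is zero in K, pointwise exactness at V' makes the projection to the cone injective on
   each [sgl E]; it is always surjective. *)
have ciso : @isom K V' (cone f).
  exists (kh (cone_proj f)); apply: (@pointwise_iso A (@all_ob A)) => //.
  - by move=> E x _ /(pe E _ I)[y <-]; rewrite f0 cmp0m.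
  - exact: leA_presented_all V'HA.1.
  - exact: leA_presented_all.
  - exact: geA_neg_acyclic V'HA.2.
  - exact: geA_neg_acyclic.
exists (ker (cone_d f)), D, (V' (Negz 0)), (V' (Posz 0)).
exists (kerm (cone_d f)), (cone_d f), (kerP (cone_d f)).1, (cone_inHA f); split.
  by have -> : cone_d f \oc injl D (V' (Negz 0)) = c := cone_d_injl f.
exact: (isom_trans VV' ciso).
Qed.

End ClassC.

Theorem proposition3p15 (A : abcat) (C : A -> Prop)
    (Cadd : additive_sub C) (Cfull : strictly_full C) (Ckar : karoubi_closed C)
    (Capp : approximating C) (ch : forall X : Kminus A, approximation C X) :
  right_t_exact (@leC A C) (@leA A) (inclTC C) /\
  exists (htau : forall X : TC C, inHC X -> inHA (tauTC C X))
         (hpi : forall X : Kminus A, inHA X -> inHC (piC ch X)),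
    right_exact_functor (tauH htau) /\
    inhabited (adjunction (tauH htau) (piH hpi)) /\
    (forall (adj : adjunction (tauH htau) (piH hpi)) (X : HC C),
       is_iso (adj_unit adj X)) /\
    exact_functor (piH hpi) /\
    (forall (adj : adjunction (tauH htau) (piH hpi)) (V : HA A),
       (classA (piH hpi) V <-> classB adj V) /\ (classB adj V <-> classC C V)).
Proof.
(* [leC] is by definition [leA] read through the inclusion. *)
split; first by move=> X.
exists (@tauTC_inHA A C), (piC_inHC Cadd ch).
set htau := @tauTC_inHA A C; set hpi := piC_inHC Cadd ch.
have adj0 : adjunction (tauH htau) (piH hpi) := tau_pi_adjunction htau hpi.
have tadd : additive_functor (tauH htau).
  exact/restrict_additive/fcompose_incl_additive/tau_additive.
have padd : additive_functor (piH hpi) := restrict_additive hpi (piC_additive ch).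
split; first exact: left_adjoint_right_exact (inhabits adj0).
split; first exact: (inhabits adj0).
split.
  (* The adjunction here is arbitrary; its unit is compared with that of the constructed one. *)
  move=> adj X; apply: adj_unit_iso.
  exact: (tau_pi_unit_iso Cadd Ckar htau hpi X).
split.
  split; first exact: padd.
  move=> X Y Z f g [fk gc]; split.
    exact: right_adjoint_kernel tadd padd adj0 fk.
  exact: piH_cokernel.
move=> adj V.
have AB : classA (piH hpi) V <-> classB adj V.
  exact: zero_iff_coker_counit tadd (piH_cokernel Cadd Ckar hpi).
have AC : classA (piH hpi) V <-> classC C V.
  split=> [/(pi_zero Cadd Ckar ch (svalP V)) V0 | VC].
    by apply: hom0_classC => // M; apply: approximating_cover.
  by apply/(pi_zero Cadd Ckar ch (svalP V)) => E x; apply: classC_hom0.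
by split=> //; rewrite -AB.
Qed.
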